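(* Let $\mathcal{I}_{\mathcal{G}}$ be an unknown self-reducible sampler and $\mathcal{I}_{\mathcal{W}}$ a known self-reducible sampler, both with output range $\{0,1\}^n$, and let $\psi$ be an input. For an error parameter $\zeta \in (0,1)$ and a constant $\delta<1/3$, the algorithm $\mathsf{CubeProbeEst}(\mathcal{I}_{\mathcal{G}},\mathcal{I}_{\mathcal{W}},\psi,\zeta,\delta)$ is a $(\zeta,\delta)$-approx $\mathsf{d_{TV}}$ estimator between $\mathcal{I}_{\mathcal{G}}$ and $\mathcal{I}_{\mathcal{W}}$, i.e. with probability at least $1-\delta$ its output $\widehat{d}$ satisfies $\mathsf{d}^{\psi}_{\mathrm{TV}}(\mathcal{I}_{\mathcal{G}},\mathcal{I}_{\mathcal{W}})-\zeta \le \widehat{d} \le \mathsf{d}^{\psi}_{\mathrm{TV}}(\mathcal{I}_{\mathcal{G}},\mathcal{I}_{\mathcal{W}})+\zeta$, and it has sample complexity $\widetilde{\mathcal{O}}(n^2/\zeta^4)$.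
   Context: A sampler $\mathcal{I}$ is a randomized algorithm that on an input $\psi\in\{0,1\}^m$ outputs an element of $\{0,1\}^n$; $\mathcal{D}^{\mathcal{I},\psi}$ denotes its output distribution, $\mathcal{D}^{\mathcal{I},\psi}(x)=\Pr[\mathcal{I}(\psi)=x]$. A sampler $\mathcal{I}_{\mathcal{W}}$ is known if $\mathcal{D}^{\mathcal{I}_{\mathcal{W}},\psi}(x)$ is explicitly available for every $\psi$ and $x$. A sampler $\mathcal{I}$ is self-reducible if for every input $\psi$, every $i$ and every $b_1\dots b_i\in\{0,1\}^i$ there is an input $\widehat{\psi}=\mathsf{SubCond}(\psi,b_1\dots b_i)$ such that $\mathcal{D}^{\mathcal{I},\widehat{\psi}}$ equals $\mathcal{D}^{\mathcal{I},\psi}$ conditioned on $x_1=b_1,\dots,x_i=b_i$ (if this event has probability $0$, the conditional distribution is taken uniform on the subcube). The total variation distance is $\mathsf{d}^{\psi}_{\mathrm{TV}}(\mathcal{I}_{\mathcal{G}},\mathcal{I}_{\mathcal{W}})=\max_{A\subseteq\{0,1\}^n}\{\mathcal{D}^{\mathcal{I}_{\mathcal{G}},\psi}(A)-\mathcal{D}^{\mathcal{I}_{\mathcal{W}},\psi}(A)\}$. Sample complexity means the number of samples drawn from the unknown sampler $\mathcal{I}_{\mathcal{G}}$ (on any inputs); $\widetilde{\mathcal{O}}$ hides polylogarithmic factors. Algorithms. $\mathsf{GBAS}(\widehat\psi,i,k,h)$: set $s\gets0,r\gets0$; while $s<k$: draw $w\sim\mathcal{D}^{\mathcal{I}_{\mathcal{G}},\widehat\psi}$,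 if $w_i=h$ set $s\gets s+1$; draw $a\sim\mathrm{Exp}(1)$ independently and set $r\gets r+a$. Return $(k-1)/r$. $\mathsf{Est}(\psi,x,\gamma,\delta')$ for $x\in\{0,1\}^n$: set $k=\lceil \frac{3n}{\gamma^2}\log\frac{2n}{\delta'}\rceil$; for $i=1,\dots,n$ let $\widehat\psi_i=\mathsf{SubCond}(\psi,x_1\dots x_{i-1})$ and $\widehat P_i=\mathsf{GBAS}(\widehat\psi_i,i,k,x_i)$; return $\prod_{i=1}^n\widehat P_i$. $\mathsf{CubeProbeEst}(\mathcal{I}_{\mathcal{G}},\mathcal{I}_{\mathcal{W}},\psi,\zeta,\delta)$: set $\alpha=\frac{2}{\zeta^2}\log\frac4\delta$, $\gamma=\frac{\zeta}{1.11(2+\zeta)}$, $\delta'=\delta/(2\alpha)$; draw $\alpha$ i.i.d. samples $x^{(1)},\dots,x^{(\alpha)}$ from $\mathcal{D}^{\mathcal{I}_{\mathcal{G}},\psi}$; return $\frac1\alpha\sum_{j=1}^{\alpha}\max\big(0,1-\mathcal{D}^{\mathcal{I}_{\mathcal{W}},\psi}(x^{(j)})/\mathsf{Est}(\psi,x^{(j)},\gamma,\delta')\big)$. *)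

(* Defs.v *)
From HB Require Import structures.
From mathcomp Require Import all_boot all_order all_algebra finmap.
From mathcomp Require Import all_classical all_reals all_analysis.

Set Implicit Arguments.
Unset Strict Implicit.
Unset Printing Implicit Defensive.

Import Order.TTheory GRing.Theory Num.Theory.
Import numFieldNormedType.Exports.

Local Open Scope classical_set_scope.
Local Open Scope ring_scope.

(* A sampler is accessed only by drawing from it (or, when known, by reading
   off its probabilities), so it is represented by its output distributions:
   [outdist I psi x] is Pr[I(psi) = x]. *)
Record sampler (R : realType) (m n : nat) := Sampler {
  outdist :> m.-tuple bool -> n.-tuple bool -> R ;
  outdist_ge0 : forall psi x, 0 <= outdist psi x ;
  outdist_sum1 : forall psi, \sum_(x : n.-tuple bool) outdist psi x = 1 }.

Definition setprob (R : realType) (m n : nat) (I : sampler R m n)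
    (psi : m.-tuple bool) (A : {set n.-tuple bool}) : R :=
  \sum_(x in A) I psi x.

Definition subcube (n : nat) (b : seq bool) : {set n.-tuple bool} :=
  [set x : n.-tuple bool | prefix b x].

Definition conddist (R : realType) (m n : nat) (I : sampler R m n)
    (psi : m.-tuple bool) (b : seq bool) (x : n.-tuple bool) : R :=
  if x \in subcube n b then
    if setprob I psi (subcube n b) == 0 then #|subcube n b|%:R^-1
    else I psi x / setprob I psi (subcube n b)
  else 0.

Definition is_subcond (R : realType) (m n : nat) (I : sampler R m n)
    (SubCond : m.-tuple bool -> seq bool -> m.-tuple bool) : Prop :=
  forall (psi : m.-tuple bool) (b : seq bool), (size b <= n)%N ->
  forall x : n.-tuple bool, I (SubCond psi b) x = conddist I psi b x.

Definition self_reducible (R : realType) (m n : nat) (I : sampler R m n) :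
    Prop :=
  exists SubCond : m.-tuple bool -> seq bool -> m.-tuple bool,
    is_subcond I SubCond.

(* The unit 0 of the iterated maximum is the value attained at A = set0. *)
Definition dTV (R : realType) (m n : nat) (IG IW : sampler R m n)
    (psi : m.-tuple bool) : R :=
  \big[Num.max/0]_(A : {set n.-tuple bool}) (setprob IG psi A - setprob IW psi A).

(* The result of a randomized computation on fixed random tapes: the returned
   value with the number of samples drawn from the unknown sampler, or [None]
   if the computation does not terminate. *)
Definition outcome (T : Type) := option (T * nat).

Fixpoint run_seq (T : Type) (cs : seq (outcome T)) : outcome (seq T) :=
  if cs is c :: cs' then
    if (c, run_seq cs') is (Some (v, N), Some (vs, M))
    then Some (v :: vs, (N + M)%N) else None
  else Some ([::], 0%N).

(* In a call to GBAS, [w t] and [a t] are the sample and the exponential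
   variable drawn in the t-th iteration of the loop; [gbas_state t] is (s, r)
   after t iterations.  Bits are numbered from 0. *)
Fixpoint gbas_state (R : realType) (n : nat) (w : nat -> n.-tuple bool)
    (a : nat -> R) (i : 'I_n) (h : bool) (t : nat) : nat * R :=
  if t is t'.+1 then
    let: (s, r) := gbas_state w a i h t' in
    ((s + (tnth (w t') i == h))%N, r + a t')
  else (0%N, 0).

Definition gbas (R : realType) (n : nat) (w : nat -> n.-tuple bool)
    (a : nat -> R) (i : 'I_n) (k : nat) (h : bool) : outcome R :=
  match pselect (exists t, ~~ ((gbas_state w a i h t).1 < k)%N) with
  | left halts =>
      let T := ex_minn halts in
      Some ((k%:R - 1) / (gbas_state w a i h T).2, T)
  | right _ => None
  end.

Definition nat_ceil (R : realType) (x : R) : nat := `|Num.ceil x|%N.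

(* [w i t phi] is the t-th sample drawn in the i-th call to GBAS, provided
   that call queries the sampler on input phi. *)
Definition est (R : realType) (m n : nat)
    (SubCond : m.-tuple bool -> seq bool -> m.-tuple bool)
    (w : 'I_n -> nat -> m.-tuple bool -> n.-tuple bool) (a : 'I_n -> nat -> R)
    (psi : m.-tuple bool) (x : n.-tuple bool) (gamma delta' : R) : outcome R :=
  let k := nat_ceil (3 * n%:R / gamma ^+ 2 * ln (2 * n%:R / delta')) in
  let call (i : 'I_n) :=
    let phi := SubCond psi (take i x) in
    gbas (fun t => w i t phi) (a i) i k (tnth x i) in
  omap (fun c : seq R * nat => (\prod_(v <- c.1) v, c.2))
    (run_seq [seq call i | i <- enum 'I_n]).

Definition cpe_alpha (R : realType) (zeta delta : R) : nat :=
  nat_ceil (2 / zeta ^+ 2 * ln (4 / delta)).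

(* [x j] is the j-th sample from the unknown sampler on input psi; [w j] and
   [a j] are the tapes of the call to Est on x j; [DW] is the (known)
   distribution of the second sampler on input psi. *)
Definition cube_probe_est (R : realType) (m n : nat)
    (SubCond : m.-tuple bool -> seq bool -> m.-tuple bool)
    (DW : n.-tuple bool -> R)
    (x : nat -> n.-tuple bool)
    (w : nat -> 'I_n -> nat -> m.-tuple bool -> n.-tuple bool)
    (a : nat -> 'I_n -> nat -> R)
    (psi : m.-tuple bool) (zeta delta : R) : outcome R :=
  let alpha := cpe_alpha zeta delta in
  let gamma := zeta / (111 / 100 * (2 + zeta)) in
  let delta' := delta / (2 * alpha%:R) in
  let probe (j : nat) :=
    omap (fun c : R * nat => (Num.max 0 (1 - DW (x j) / c.1), c.2.+1))
      (est SubCond (w j) (a j) psi (x j) gamma delta') in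
  omap (fun c : seq R * nat => ((\sum_(v <- c.1) v) / alpha%:R, c.2))
    (run_seq [seq probe j | j <- iota 0 alpha]).

Definition nsamples (R : realType) (T : Type) (c : outcome T) : \bar R :=
  if c is Some (_, N) then (N%:R)%:E else +oo%E.

Definition mutually_independent (d : measure_display) (Om : measurableType d)
    (R : realType) (P : probability Om R) (I : choiceType)
    (F : I -> set (set Om)) : Prop :=
  forall (J : {fset I}) (E : I -> set Om), (forall i, i \in J -> F i (E i)) ->
    P (\bigcap_(i in [set` J]) E i) = (\prod_(i <- J) P (E i))%E.

Section tapes.
Variables (d : measure_display) (Om : measurableType d) (R : realType).
Variables (P : probability Om R) (m n : nat).
Variables (x : nat -> Om -> n.-tuple bool).
Variables (w : nat -> 'I_n -> nat -> m.-tuple bool -> Om -> n.-tuple bool).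
Variables (a : nat -> 'I_n -> nat -> Om -> R).

Definition tape_cell : choiceType :=
  (nat + (nat * 'I_n * nat * m.-tuple bool) + (nat * 'I_n * nat))%type.

Definition tape_events (c : tape_cell) : set (set Om) :=
  match c with
  | inl (inl j) => [set x j @^-1` A | A in setT]
  | inl (inr (j, i, t, phi)) => [set w j i t phi @^-1` A | A in setT]
  | inr (j, i, t) => [set a j i t @^-1` B | B in measurable]
  end.

(* Every draw made by the algorithm, whatever the input it is made on, is a
   fresh one: all cells of the tapes are mutually independent. *)
Record random_tapes (I : sampler R m n) (psi : m.-tuple bool) : Prop := {
  tape_measurable : forall c, tape_events c `<=` measurable ;
  tape_x_law : forall j y, P (x j @^-1` [set y]) = (I psi y)%:E ;
  tape_w_law : forall j i t phi y,
    P (w j i t phi @^-1` [set y]) = (I phi y)%:E ;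
  tape_a_law : forall j i t (B : set R), measurable B ->
    P (a j i t @^-1` B) = exponential_prob 1 B ;
  tape_indep : mutually_independent P tape_events }.

End tapes.

(* Main.v *)
Require Import Defs.
From HB Require Import structures.
From mathcomp Require Import all_boot all_order all_algebra finmap.
From mathcomp Require Import all_classical all_reals all_analysis.
From mathcomp Require Import measurable_realfun.
From mathcomp Require Import ring lra.

(** Fix a sampled string y with conditional bit probabilities p_i, so that the
    probability of y is the product of the p_i, and let r_i be the clock returned
    by the i-th call to GBAS.  For theta < 1 the process
    exp(theta p_i r) (1 - theta)^s is a martingale along the loop of GBAS, and
    stopping it at s = k gives E[exp(theta p_i r_i)] <= (1 - theta)^-k, as if
    p_i r_i were Gamma(k).  Write g_i = p_i r_i / (k - 1); then Est returns
    Pr[y] divided by the product of the g_i.  Chernoff bounds applied to every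
    single g_i and to their sum (the calls are independent) give, outside an event
    of probability delta', the bounds |g_i - 1| <= D / sqrt n and
    |sum (g_i - 1)| <= D with D = zeta / (2 + zeta).  Together they put the product
    within zeta / 2 of 1: its logarithm is sum (g_i - 1) up to sum (g_i - 1)^2 <= D^2.
    Since the error on max(0, 1 - W / Est) is at most |1 - prod g_i|, the other half
    of zeta is spent in Hoeffding's inequality for the average of
    max(0, 1 - W / G), whose mean is the total variation distance.

    For the sample complexity, p_i times the expected length of a call is at most k
    (Wald), and the mean of 1 / p_i over a random string is at most 2. *)

Set Implicit Arguments.
Unset Strict Implicit.
Unset Printing Implicit Defensive.

Import Order.TTheory GRing.Theory Num.Theory.
Import numFieldNormedType.Exports.

Local Open Scope classical_set_scope.
Local Open Scope ring_scope.

(** * Exponential inequalities *)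

(** Bounding each factor alone is not enough: with [k] of order n / gamma^2, up to a logarithm, a
    single g_i is only accurate to D / sqrt n, and n such errors could add up to D sqrt n. Hence the
    separate tail bound for the sum, where independent errors cancel; the individual bounds serve
    mainly to control second-order terms. With t = zeta / 2, the choice D = t / (1 + t) gives 1 / (1
    - D) = 1 + t; the gamma of the algorithm is D / 1.11, and the factor 1.11^2 thus gained in [k]
    pays for crude exponential inequalities.

    The law of r_i is never identified: the inequality on its exponential moment suffices, with
    theta of either sign. The string y is itself random and decides on which inputs the sampler is
    queried; it is frozen by summing over its values, since its cell is independent of the cells
    read by Est. This takes independence of the sigma-algebras generated by disjoint sets of cells,
    not only of single cells. Calls with p_i = 0 can run forever, so strings of probability 0 have
    to be set aside as a null event. *)

Section real_inequalities.
Variable R : realType.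
Implicit Types x y u e lam mu : R.

Lemma expR_ge_quad x : 0 <= x -> 1 + x + x ^+ 2 / 2 <= expR x.
Proof.
move=> x0; rewrite /expR.
have -> : 1 + x + x ^+ 2 / 2 = series (exp_coeff x) 3.
  rewrite /series/= !big_nat_recr//= big_geq// /exp_coeff/=.
  by rewrite add0r expr0 expr1 !factS fact0 !muln1 !divr1.
apply: nondecreasing_cvgn_le; last exact: is_cvg_series_exp_coeff.
apply/nondecreasing_seqP => n; rewrite /series/= big_nat_recr//= lerDl.
by rewrite /exp_coeff/= divr_ge0// exprn_ge0.
Qed.

(** The bound ln (1 + u) >= u - u^2 in exponential form. Both signs bound exp (u^2 - u) below by a
    polynomial v with (1 + u) v >= 1: the tangent for u >= 0, where (1 + u) (1 - u + u^2) = 1 + u^3,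
    and the quadratic Taylor polynomial for u < 0. *)
Lemma expR_sub_sqr_le u : -3^-1 <= u <= 3^-1 -> expR (u - u ^+ 2) <= 1 + u.
Proof.
move=> /andP[u1 u2].
have inv_le y v : 0 < v -> v^-1 <= 1 + u -> v <= expR y -> expR (- y) <= 1 + u.
  move=> v0 vu ve; rewrite expRN; apply: le_trans vu.
  by rewrite lef_pV2// posrE ?expR_gt0.
have [u0|u0] := leP 0 u.
  rewrite -[u - _]opprK; apply: (inv_le _ (1 - u + u ^+ 2)); first by nra.
    have v0 : 0 < 1 - u + u ^+ 2 by nra.
    by rewrite -[_^-1]mul1r ler_pdivrMr//; nra.
  by apply: le_trans (expR_ge1Dx _); lra.
rewrite -[u - _]opprK; set y := - (u - u ^+ 2).
apply: (inv_le _ (1 + y + y ^+ 2 / 2)).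
- by rewrite /y; nra.
- have v0 : 0 < 1 + y + y ^+ 2 / 2 by rewrite /y; nra.
  rewrite -[_^-1]mul1r ler_pdivrMr//.
  have -> : (1 + u) * (1 + y + y ^+ 2 / 2) =
    1 + u ^+ 2 * (2^-1 + u / 2 * (1 - u + u ^+ 2)) by rewrite /y; field.
  rewrite lerDl mulr_ge0 ?sqr_ge0//.
  have : 0 <= (3^-1 + u) * (1 - u + u ^+ 2) by apply: mulr_ge0; nra.
  nra.
- by apply: expR_ge_quad; rewrite /y; nra.
Qed.

(** Upper bound on ln (1 + e), for the upper tail. With 3/8, the terms of order e^2 and e^3 in the
    gap to the quadratic Taylor polynomial balance exactly at e = 1/3. *)
Lemma ge1D_le_expR e : 0 <= e <= 3^-1 -> 1 + e <= expR (e - 3 / 8 * e ^+ 2).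
Proof.
move=> /andP[e0 e1]; apply: le_trans (expR_ge_quad _); last by nra.
rewrite -subr_ge0.
have -> : 1 + (e - 3 / 8 * e ^+ 2) + (e - 3 / 8 * e ^+ 2) ^+ 2 / 2 - (1 + e) =
  e ^+ 2 * (3 / 8 * (3^-1 - e) + 9 / 128 * e ^+ 2) by field.
by rewrite mulr_ge0 ?sqr_ge0//; nra.
Qed.

(** The upper bound (1 - x/4)^-4 of exp x expands as 1 + x + 5/8 x^2 + ..., so 5/8 is the
    coefficient for which the terms of order e^2 cancel and a multiple of e^3 remains. *)
Lemma expR_le_ge1D e : 0 <= e <= 3^-1 -> expR (e - 5 / 8 * e ^+ 2) <= 1 + e.
Proof.
move=> /andP[e0 e1]; set x := e - _.
have x4 : 1 - x / 4 <= expR (- (x / 4)) by apply: expR_ge1Dx.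
have x0 : 0 <= x by rewrite /x; nra.
have x40 : 0 < 1 - x / 4 by rewrite /x; nra.
have -> : expR x = (expR (- (x / 4)) ^+ 4)^-1.
  by rewrite -expRM_natl -expRN; congr expR; field.
rewrite -[_^-1]mul1r ler_pdivrMr ?exprn_gt0 ?expR_gt0//.
have h : (1 - x / 4) ^+ 4 <= expR (- (x / 4)) ^+ 4.
  by apply: lerXn2r => //; rewrite nnegrE ?expR_ge0 ?ltW.
apply: (@le_trans _ _ ((1 + e) * (1 - x / 4) ^+ 4)); last first.
  by rewrite ler_pM2l//; lra.
have h2 : 1 - x + 3 / 8 * x ^+ 2 - x ^+ 3 / 16 <= (1 - x / 4) ^+ 4.
  have -> : (1 - x / 4) ^+ 4 = 1 - x + 3 / 8 * x ^+ 2 - x ^+ 3 / 16 + (x / 4) ^+ 4 by field.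
  by rewrite lerDl exprn_ge0 // divr_ge0.
apply: (@le_trans _ _ ((1 + e) * (1 - x + 3 / 8 * x ^+ 2 - x ^+ 3 / 16))); last first.
  by rewrite ler_pM2l//; lra.
rewrite -subr_ge0 /x.
have -> : (1 + e) * (1 - (e - 5 / 8 * e ^+ 2) + 3 / 8 * (e - 5 / 8 * e ^+ 2) ^+ 2
     - (e - 5 / 8 * e ^+ 2) ^+ 3 / 16) - 1 =
  e ^+ 3 * ((5 / 8 + 3 / 8 - 15 / 32 - 1 / 16)
   + e * (- 15 / 32 + 75 / 512 + 15 / 128 - 1 / 16)
   + e ^+ 2 * (75 / 512 - 75 / 1024 + 15 / 128)
   + e ^+ 3 * (125 / 8192 - 75 / 1024) + e ^+ 4 * (125 / 8192)) by field.
apply: mulr_ge0; first exact: exprn_ge0.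
have e2 : 0 <= e ^+ 2 by apply: sqr_ge0.
have e3 : 0 <= e ^+ 3 <= e ^+ 2.
  by rewrite exprn_ge0//= ler_wiXn2l//; lra.
have e4 : 0 <= e ^+ 4 by apply: exprn_ge0.
lra.
Qed.

Lemma is_derive_ge0_le (f df : R -> R) x : 0 <= x ->
  (forall y, 0 <= y -> is_derive y 1 f (df y)) -> (forall y, 0 <= y -> 0 <= df y) ->
  f 0 <= f x.
Proof.
move=> x0 fdf df0.
have [||c cx] := @MVT_segment _ f df 0 x x0.
- by move=> y; rewrite in_itv/= => /andP[/ltW y0 _]; exact: fdf.
- apply: derivable_within_continuous => y; rewrite in_itv/= => /andP[y0 _].
  by apply: ex_derive; exact: fdf.
move: cx; rewrite in_itv/= => /andP[c0 _].
by rewrite -subr_ge0 => ->; rewrite subr0 mulr_ge0// df0.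
Qed.

(** Hoeffding's lemma. The gap [phi] between the logarithms of the two sides vanishes at 0 together
    with its derivative [h], and h' = 1/4 - q (1 - q) >= 0 for q = mu exp y / v y. *)
Lemma hoeffding_bernoulli mu lam : 0 <= mu <= 1 -> 0 <= lam ->
  1 - mu + mu * expR lam <= expR (lam * mu + lam ^+ 2 / 8).
Proof.
move=> /andP[mu0 mu1] lam0.
pose v y := 1 - mu + mu * expR y.
have v0 y : 0 < v y.
  rewrite /v; have [->|mun0] := eqVneq mu 0; first by rewrite mul0r; lra.
  rewrite ltr_wpDl ?subr_ge0// mulr_gt0 ?expR_gt0//.
  by rewrite lt_neqAle eq_sym mun0.
have dv y : is_derive y 1 v (mu * expR y).
  rewrite /v; apply: is_derive_eq.
  rewrite /GRing.scale/=; ring.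
pose h y := mu + y / 4 - (1 - (1 - mu) * (v y)^-1).
have h_ge0 y : 0 <= y -> 0 <= h y.
  move=> y0.
  have -> : 0 = h 0.
    by rewrite /h /v expR0 mulr1 subrK invr1 mulr1 mul0r addr0 subKr subrr.
  pose dh z := 4^-1 - (1 - mu) * (mu * expR z) / (v z) ^+ 2.
  apply: (@is_derive_ge0_le _ dh _ y0) => z z0.
    rewrite /h.
    have vz0 : v z != 0 by rewrite gt_eqF.
    have dvi := @is_deriveV _ v z (mu * expR z) 1 vz0 (dv z).
    apply: is_derive_eq.
    rewrite /dh /GRing.scale/=.
    by field.
  rewrite /dh subr_ge0 ler_pdivrMr ?exprn_gt0// /v.
  have := sqr_ge0 (1 - mu - mu * expR z); lra.
rewrite -[leLHS]lnK ?posrE ?v0// ler_expR -subr_ge0.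
pose phi y := y * mu + y ^+ 2 / 8 - ln (v y).
have -> : 0 = phi 0.
  by rewrite /phi /v expR0 mulr1 subrK ln1 !mul0r expr0n mul0r addr0 subr0.
apply: (@is_derive_ge0_le _ h _ lam0) => y y0; last exact: h_ge0.
have dl := is_derive1_ln (v0 y).
have dlv : is_derive y 1 (fun y => ln (v y)) ((v y)^-1 * (mu * expR y)).
  exact: (@is_derive1_comp _ (@ln R) v y (v y)^-1 (mu * expR y)).
rewrite /phi; apply: is_derive_eq.
have vy0 : v y != 0 by rewrite gt_eqF.
rewrite /h /GRing.scale/=.
have -> : mu * expR y = v y - (1 - mu) by rewrite /v addrC addKr.
by field.
Qed.

(** Rational source of the later numerical bounds exp 1 <= 3 and exp (7/2) <= 48: at so small an
    exponent, exp (-x) >= 1 - x is accurate enough. *)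
Lemma expR_eighth_le : expR (1 / 8) <= 8 / 7 :> R.
Proof.
rewrite -[1 / 8]opprK expRN -[8 / 7]invrK.
rewrite lef_pV2 ?posrE ?expR_gt0 ?invr_gt0 ?divr_gt0//.
by apply: le_trans (expR_ge1Dx _); lra.
Qed.

End real_inequalities.

(** * Independence of blocks of cells *)

Section independent_maps.
Local Open Scope ereal_scope.
Context (d d1 d2 : measure_display) (Om : measurableType d).
Context (T1 : measurableType d1) (T2 : measurableType d2) (R : realType).
Variables (P : probability Om R) (X1 : Om -> T1) (X2 : Om -> T2).
Hypotheses (mX1 : measurable_fun setT X1) (mX2 : measurable_fun setT X2).
Hypothesis X12 : forall A B, measurable A -> measurable B ->
  P (X1 @^-1` A `&` X2 @^-1` B) = P (X1 @^-1` A) * P (X2 @^-1` B).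

(** The joint law agrees with the product of the marginal laws on rectangles, hence everywhere, and
    Tonelli factors the integral. *)
Lemma integral_mul_independent (f : T1 -> \bar R) (g : T2 -> \bar R) :
  measurable_fun setT f -> measurable_fun setT g ->
  (forall t, 0 <= f t) -> (forall t, 0 <= g t) ->
  \int[P]_om (f (X1 om) * g (X2 om)) =
  (\int[P]_om f (X1 om)) * (\int[P]_om g (X2 om)).
Proof.
move=> mf mg f0 g0.
pose Y1 : {mfun Om >-> T1} := HB.pack X1 (isMeasurableFun.Build _ _ _ _ _ mX1).
pose Y2 : {mfun Om >-> T2} := HB.pack X2 (isMeasurableFun.Build _ _ _ _ _ mX2).
have mX : measurable_fun setT (fun om => (X1 om, X2 om)).
  exact: measurable_fun_pair.
pose Y : {mfun Om >-> (T1 * T2)%type} :=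
  HB.pack (fun om => (X1 om, X2 om)) (isMeasurableFun.Build _ _ _ _ _ mX).
pose P1 : probability T1 R := distribution P Y1.
pose P2 : probability T2 R := distribution P Y2.
pose P12 : probability (T1 * T2)%type R := distribution P Y.
have PE : forall A, measurable A -> (P1 \x P2) A = P12 A.
  apply: product_measure_unique => A B mA mB.
  by rewrite /P12 /P1 /P2 /distribution/= /pushforward/= -X12.
pose h (z : T1 * T2) := f z.1 * g z.2.
have mh : measurable_fun setT h.
  by apply: emeasurable_funM; apply: measurableT_comp.
have h0 z : 0 <= h z by rewrite mule_ge0.
have -> : \int[P]_om (f (X1 om) * g (X2 om)) = \int[P12]_z h z.
  by rewrite (ge0_integral_distribution Y).
rewrite (eq_measure_integral (P1 \x P2)); last by move=> A mA _; exact/esym/PE.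
rewrite fubini_tonelli1//.
rewrite (eq_integral (fun x => f x * \int[P2]_z g z)); last first.
  by move=> x _; rewrite /fubini_F -ge0_integralZl.
have -> : \int[P]_om g (X2 om) = \int[P2]_z g z.
  by rewrite (ge0_integral_distribution Y2).
rewrite ge0_integralZr//; last exact: integral_ge0.
by rewrite (ge0_integral_distribution Y1).
Qed.

End independent_maps.

Section independent_blocks.
Context (d : measure_display) (Om : measurableType d) (R : realType).
Variables (P : probability Om R) (I : choiceType) (F : I -> set (set Om)).
Hypothesis F_measurable : forall i, F i `<=` measurable.
Hypothesis F_setT : forall i, F i setT.
Hypothesis F_setI : forall i, setI_closed (F i).
Hypothesis F_indep : mutually_independent P F.

Definition block_rects (S : set I) : set (set Om) :=
  [set A | exists (J : {fset I}) (E : I -> set Om),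
    [/\ [set` J] `<=` S, forall i, F i (E i) & A = \bigcap_(i in [set` J]) E i]].

(** The same space under a coarser sigma-algebra: measurability of a function on [block_space S]
    encodes that it depends only on the cells in [S]. *)
Definition block_space (S : set I) := g_sigma_algebraType (block_rects S).

Lemma block_rects_setI S : setI_closed (block_rects S).
Proof.
move=> _ _ [J1 [E1 [J1S FE1 ->]]] [J2 [E2 [J2S FE2 ->]]].
pose E i := (if i \in J1 then E1 i else setT) `&` (if i \in J2 then E2 i else setT).
exists (J1 `|` J2)%fset, E; split.
- by move=> i /=; rewrite in_fsetU => /orP[/J1S|/J2S].
- by move=> i; apply: F_setI; case: ifPn.
- apply/seteqP; split => om.
    move=> [h1 h2] i /= _; split; case: ifPn => // iJ; [exact: h1|exact: h2].
  move=> h; split => i /= iJ.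
    by have := h i; rewrite /= in_fsetU iJ /E iJ => /(_ isT)[].
  by have := h i; rewrite /= in_fsetU iJ orbT /E iJ => /(_ isT)[].
Qed.

Lemma block_rects_measurable S : block_rects S `<=` measurable.
Proof.
move=> _ [J [E [_ FE ->]]]; apply: fin_bigcap_measurable => //.
by move=> i _; exact/F_measurable/FE.
Qed.

Lemma block_space_measurable S (A : set Om) :
  @measurable _ (block_space S) A -> measurable A.
Proof.
apply: smallest_sub; first exact: sigma_algebra_measurable.
exact: block_rects_measurable.
Qed.

Lemma block_id_measurable S : measurable_fun setT (id : Om -> block_space S).
Proof. by move=> _ A mA; rewrite setTI preimage_id; exact: block_space_measurable mA. Qed.

Lemma block_cell_measurable S i A : S i -> F i A ->
  @measurable _ (block_space S) A.
Proof.
move=> Si FA; apply: sub_gen_smallest; exists [fset i]%fset, (fun j => if j == i then A else setT).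
split.
- by move=> j /=; rewrite in_fset1 => /eqP->.
- by move=> j; case: eqP => [->|].
- by rewrite set_fset1 bigcap_set1 eqxx.
Qed.

Variables (S1 S2 : set I).
Hypothesis S12 : S1 `&` S2 = set0.

Lemma block_rects_independent A B : block_rects S1 A -> block_rects S2 B ->
  P (A `&` B) = (P A * P B)%E.
Proof.
move=> [J1 [E1 [J1S FE1 ->]]] [J2 [E2 [J2S FE2 ->]]].
have J12 i : i \in J1 -> i \in J2 -> False.
  by move=> /J1S i1 /J2S i2; rewrite -[False]/(set0 i) -S12.
pose E i := if i \in J1 then E1 i else E2 i.
have -> : \bigcap_(i in [set` J1]) E1 i `&` \bigcap_(i in [set` J2]) E2 i =
    \bigcap_(i in [set` (J1 `|` J2)%fset]) E i.
  apply/seteqP; split => om.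
    move=> [h1 h2] i /=; rewrite in_fsetU /E.
    by case: ifPn => [iJ _|_ /=]; [exact: h1|exact: h2].
  move=> h; split => i /= iJ.
    by have := h i; rewrite /= in_fsetU iJ /E iJ; exact.
  have := h i; rewrite /= in_fsetU iJ orbT /E ifN; last first.
    by apply/negP => /J12; exact.
  by apply.
rewrite !F_indep//; last by move=> i _; rewrite /E; case: ifPn.
have dJ : [disjoint J1 & J2]%fset.
  by apply/fdisjointP => i /J12 h; apply/negP.
have -> : (\prod_(i <- (J1 `|` J2)%fset) P (E i))%E =
    (\prod_(i <- J1 ++ J2) P (E i))%E.
  apply: perm_big; apply: uniq_perm; rewrite ?fset_uniq//.
    rewrite cat_uniq !fset_uniq/= andbT; apply/hasPn => i iJ2.
    by apply/negP => iJ1; exact: (J12 i).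
  by move=> i; rewrite in_fsetU mem_cat.
rewrite big_cat/=; congr (_ * _)%E.
  by apply: eq_big_seq => i iJ; rewrite /E iJ.
apply: eq_big_seq => i iJ; rewrite /E ifN//.
by apply/negP => /J12; exact.
Qed.

Let mP A : measurable A -> P A \is a fin_num.
Proof. exact: fin_num_measure. Qed.

(** Dynkin's argument: for fixed [B], the events independent of [B] are stable under complements and
    countable disjoint unions, so independence passes from a pi-system to the sigma-algebra it
    generates. *)
Lemma independent_of_rects (G : set (set Om)) (B : set Om) :
  G `<=` measurable -> setI_closed G -> measurable B ->
  (forall A, G A -> P (A `&` B) = (P A * P B)%E) ->
  forall A, <<s G >> A -> P (A `&` B) = (P A * P B)%E.
Proof.
move=> Gm GI mB GB.
pose T := g_sigma_algebraType G.
have Tm (A : set Om) : @measurable _ T A -> measurable A.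
  by apply: smallest_sub => //; exact: sigma_algebra_measurable.
have PC (A : set Om) : measurable A -> P (A `&` B) = (P A * P B)%E ->
    P (~` A `&` B) = (P (~` A) * P B)%E.
  move=> mA PA; rewrite setIC -setDE.
  have -> : P (B `\` A) = (P B - P (A `&` B))%E.
    by rewrite measureD 1?setIC// ltey_eq mP.
  rewrite PA probability_setC// muleBl ?mul1e ?mP//.
have PU (A : (set Om)^nat) : (forall n, measurable (A n)) -> trivIset setT A ->
    (forall n, P (A n `&` B) = (P (A n) * P B)%E) ->
    P (\bigcup_n A n `&` B) = (P (\bigcup_n A n) * P B)%E.
  move=> mA tA PA; rewrite setI_bigcupl measure_semi_bigcup//=; first last.
  - by apply: bigcupT_measurable => n; exact: measurableI.
  - exact: trivIset_setIr.
  - by move=> n; exact: measurableI.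
  rewrite measure_semi_bigcup//; last exact: bigcupT_measurable.
  rewrite muleC -(fineK (mP mB)) -nneseriesZl//.
  by apply: eq_eseriesr => n _; rewrite PA muleC fineK// mP.
apply: (@dynkin_induction _ T) => //=.
- by rewrite setTI probability_setT mul1e.
- by move=> A /Tm mA; exact: PC.
- by move=> A mA tA; apply: PU => // n; exact: Tm.
Qed.

(** Two Dynkin extensions: first the block [S2] is extended from rectangles, against a fixed event
    of [S1]; the remaining case of a single rectangle is then the extension of the block [S1]. *)
Lemma block_independent A B : @measurable _ (block_space S1) A ->
  @measurable _ (block_space S2) B -> P (A `&` B) = (P A * P B)%E.
Proof.
move=> mA mB; have mA' := block_space_measurable mA.
rewrite setIC muleC.
apply: (independent_of_rects _ _ mA' _ mB).
- exact: block_rects_measurable.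
- exact: block_rects_setI.
move=> {mB}B rB; rewrite setIC muleC.
have mB := block_rects_measurable rB.
apply: (independent_of_rects _ _ mB _ mA).
- exact: block_rects_measurable.
- exact: block_rects_setI.
by move=> A' rA; exact: block_rects_independent.
Qed.

(** The form in which independence is used from here on. The two random variables are the identity
    of [Om], seen as a map into two coarser sigma-algebras. *)
Lemma integral_mul_blocks (f g : Om -> \bar R) :
  measurable_fun setT (f : block_space S1 -> _) ->
  measurable_fun setT (g : block_space S2 -> _) ->
  (forall om, 0 <= f om)%E -> (forall om, 0 <= g om)%E ->
  (\int[P]_om (f om * g om) = (\int[P]_om f om) * (\int[P]_om g om))%E.
Proof.
move=> mf mg f0 g0.
apply: (@integral_mul_independent _ _ _ Om (block_space S1) (block_space S2) R P
  id id (@block_id_measurable S1) (@block_id_measurable S2) _ f g) => //.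
by move=> A B mA mB; exact: block_independent.
Qed.

End independent_blocks.

(** * Exponential moments *)

Lemma integral_indic_probability (d : measure_display) (T : measurableType d)
    (R : realType) (P : probability T R) (A : set T) :
  measurable A -> (\int[P]_x (\1_A x)%:E = P A)%E.
Proof. by move=> mA; rewrite integral_indic// setIT. Qed.

Lemma integral_cst_probability (d : measure_display) (T : measurableType d)
    (R : realType) (P : probability T R) (r : \bar R) :
  (\int[P]_x r = r)%E.
Proof.
by rewrite integral_cst// -[RHS]mule1; congr (_ * _)%E; exact: probability_setT.
Qed.

Section exponential_moments.
Local Open Scope ereal_scope.

Import HBNNSimple.

(** Change of measure, checked on simple functions and passed to the limit by monotone convergence;
    it gives access to [exponential_prob], which is defined through its density. *)
Lemma ge0_integral_density (d : measure_display) (T : measurableType d)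
    (R : realType) (mu nu : {measure set T -> \bar R}) (f : T -> R)
    (g : T -> \bar R) :
  measurable_fun setT f -> (forall x, 0 <= f x)%R ->
  (forall A, measurable A -> nu A = \int[mu]_(x in A) (f x)%:E) ->
  measurable_fun setT g -> (forall x, 0 <= g x) ->
  \int[nu]_x g x = \int[mu]_x ((f x)%:E * g x).
Proof.
move=> mf f0 nuE mg g0.
have nnsE (h : {nnsfun T >-> R}) :
    \int[nu]_x (h x)%:E = \int[mu]_x ((f x)%:E * (h x)%:E).
  under [LHS]eq_integral do rewrite fimfunE -fsumEFin//.
  rewrite [LHS]ge0_integral_fsum//; last 2 first.
    - by move=> r; exact/measurable_EFinP/measurableT_comp.
    - by move=> n x _; rewrite EFinM nnfun_muleindic_ge0.
  under [RHS]eq_integral.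
    move=> x xD; rewrite fimfunE -fsumEFin// ge0_mule_fsumr; last first.
      by move=> r; rewrite EFinM nnfun_muleindic_ge0.
    over.
  rewrite [RHS]ge0_integral_fsum//; last 2 first.
    - move=> r; apply: emeasurable_funM; first exact/measurable_EFinP.
      by apply/measurable_EFinP; do 2 apply/measurableT_comp => //.
    - move=> n x _; rewrite mule_ge0 ?lee_fin// -lee_fin EFinM.
      by rewrite nnfun_muleindic_ge0.
  apply: eq_fsbigr => r _; rewrite integralZl_indic_nnsfun// integral_indic//.
  have mA : measurable (h @^-1` [set r]) by [].
  rewrite setIT nuE//.
  under [RHS]eq_integral do rewrite EFinM muleCA.
  have [r0|r0] := ltP r 0%R.
    rewrite preimage_nnfun0// integral_set0 mule0 integral0_eq// => x _.
    by rewrite indic0/= mule0 mule0.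
  rewrite [RHS]ge0_integralZl//.
  - congr (_ * _); rewrite integral_mkcond; apply: eq_integral => x _.
    by rewrite patchE indicE; case: ifPn; rewrite ?mule1 ?mule0.
  - by apply: emeasurable_funM; apply/measurable_EFinP.
  - by move=> x _; rewrite mule_ge0 ?lee_fin.
pose h := nnsfun_approx measurableT mg.
have hg x : limn (EFin \o h^~ x) = g x.
  by apply/cvg_lim => //; apply: cvg_nnsfun_approx.
transitivity (limn (fun n => \int[nu]_x (h n x)%:E)).
  rewrite -monotone_convergence//=.
  - by apply: eq_integral => x _; rewrite -hg.
  - by move=> n; exact/measurable_EFinP.
  - by move=> n x _; rewrite lee_fin.
  - by move=> x _ m n mn; rewrite lee_fin; exact/lefP/nd_nnsfun_approx.
transitivity (limn (fun n => \int[mu]_x ((f x)%:E * (h n x)%:E))).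
  suff -> : (fun n => \int[nu]_x (h n x)%:E) =
      (fun n => \int[mu]_x ((f x)%:E * (h n x)%:E)) by [].
  by apply/funext => n; rewrite nnsE.
rewrite -monotone_convergence//=.
- apply: eq_integral => x _; rewrite -hg; apply/cvg_lim => //.
  apply: cvgeMl => //; apply/cvg_ex; exists (g x).
  exact: cvg_nnsfun_approx.
- by move=> n; apply: emeasurable_funM; exact/measurable_EFinP.
- by move=> n x _; rewrite mule_ge0 ?lee_fin.
- move=> x _ m n mn; rewrite lee_wpmul2l ?lee_fin//.
  exact/lefP/nd_nnsfun_approx.
Qed.

(** Multiplying the density of Exp(1) by exp (c x) gives (1 - c)^-1 times the density of Exp(1 - c),
    whose total mass is 1. *)
Lemma exponential_mgf (d : measure_display) (Om : measurableType d)
    (R : realType) (P : probability Om R) (a : Om -> R) (c : R) :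
  measurable_fun setT a ->
  (forall B, measurable B -> P (a @^-1` B) = exponential_prob 1 B) ->
  (c < 1)%R -> \int[P]_om (expR (c * a om))%:E = ((1 - c)^-1)%:E.
Proof.
move=> ma Pa c1.
have maR : measurable_fun setT (a : Om -> measurableTypeR R) by exact: ma.
pose Y : {mfun Om >-> measurableTypeR R} :=
  HB.pack (a : Om -> measurableTypeR R) (isMeasurableFun.Build _ _ _ _ _ maR).
have meR : measurable_fun setT (fun x : R => expR (c * x)).
  by apply: measurableT_comp => //; exact: measurable_funM.
have me : measurable_fun setT (fun x : measurableTypeR R => expR (c * x)).
  exact: meR.
rewrite -(ge0_integral_distribution Y (f := fun x => (expR (c * x))%:E)); last 2 first.
  - exact/measurable_EFinP.
  - by move=> x; rewrite lee_fin expR_ge0.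
rewrite (@ge0_integral_density _ (measurableTypeR R) R lebesgue_measure (distribution P Y)
  (exponential_pdf 1)); first last.
- by move=> x; rewrite lee_fin expR_ge0.
- exact/measurable_EFinP.
- by move=> A mA; rewrite -[LHS]/(P (a @^-1` A)) Pa.
- by move=> x; exact: exponential_pdf_ge0.
- exact: measurable_exponential_pdf.
have c10 : (0 < 1 - c)%R by rewrite subr_gt0.
have mpdf : measurable_fun setT (exponential_pdf (1 - c) : measurableTypeR R -> R).
  exact: measurable_exponential_pdf.
rewrite (eq_integral (fun x : measurableTypeR R =>
  ((1 - c)^-1)%:E * (exponential_pdf (1 - c) x)%:E)).
  rewrite ge0_integralZl//.
  - by rewrite integral_exponential_pdf// mule1.
  - exact/measurable_EFinP.
  - by move=> x _; rewrite lee_fin exponential_pdf_ge0// ltW.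
  - by rewrite lee_fin invr_ge0 ltW.
move=> x _; rewrite -!EFinM; congr EFin.
have [x0|x0] := ltP x 0%R; first by rewrite !lt0_exponential_pdf// mulr0 mul0r.
rewrite !exponential_pdfE//= mul1r mulrA mulVf ?gt_eqF// mul1r -expRD.
by congr expR; rewrite mulN1r mulNr mulrBl mul1r opprB addrC.
Qed.

End exponential_moments.

(** * The stopped random walk of GBAS *)

(* [b t] says whether the t-th draw is a success, [a t] is the t-th exponential
   increment; [clock] is the variable r of GBAS. *)
Section gbas_run.
Context (Om : Type) (R : realType) (b : nat -> Om -> bool) (a : nat -> Om -> R).
Variables (k : nat).
Implicit Types (t : nat) (om : Om).

Definition hits t om : nat := \sum_(u < t) b u om.
Definition clock t om : R := \sum_(u < t) a u om.
Definition alive t om : bool := (hits t om < k)%N.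
(** Index shift: draw number t is the last one, so the stop time is [t.+1]. *)
Definition stops t om : bool := alive t om && ~~ alive t.+1 om.
Definition halts om : Prop := exists t, ~~ alive t om.

(** The default 0 on runs that never halt makes [stop_clock] an empty sum there. *)
Definition stop_time om : nat :=
  match pselect (halts om) with left h => ex_minn h | right _ => 0 end.
Definition stop_clock om : R := clock (stop_time om) om.

Definition gmart (p theta : R) t om : R :=
  expR (theta * p * clock t om) * (1 - theta) ^+ hits t om.
(** At most one term is nonzero, and none on runs that never halt. As a series of nonnegative terms
    it is measurable without any reference to the stop time. *)
Definition stopped_gmart p theta om : \bar R :=
  (\sum_(0 <= t <oo) (gmart p theta t.+1 om * (stops t om)%:R)%:E)%E.
(** The number of draws as an extended real: +oo on runs that never halt, in agreement with
    [nsamples] of [None]. *)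
Definition lifetime om : \bar R := (\sum_(0 <= t <oo) ((alive t om)%:R)%:E)%E.

Lemma hitsS t om : hits t.+1 om = (hits t om + b t om)%N.
Proof. by rewrite /hits big_ord_recr. Qed.

Lemma clockS t om : clock t.+1 om = clock t om + a t om.
Proof. by rewrite /clock big_ord_recr. Qed.

Lemma aliveS t om : alive t.+1 om -> alive t om.
Proof. by rewrite /alive hitsS; apply: leq_ltn_trans; exact: leq_addr. Qed.

Lemma alive_le s t om : (s <= t)%N -> alive t om -> alive s om.
Proof.
move=> /subnKC <-; elim: (t - s)%N => [|n IH]; first by rewrite addn0.
by rewrite addnS => /aliveS.
Qed.

Lemma haltsN om : ~ halts om <-> forall t, alive t om.
Proof.
split=> [h t|h [t]]; last by rewrite h.
by apply/negPn/negP => nt; apply: h; exists t.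
Qed.

Lemma stop_timeP om : halts om ->
  ~~ alive (stop_time om) om /\ forall t, (t < stop_time om)%N -> alive t om.
Proof.
rewrite /stop_time; case: pselect => // h _; case: ex_minnP => T nT minT.
split=> // t tT; apply/negPn/negP => /minT; by rewrite leqNgt tT.
Qed.

Lemma alive_stop_time om t : halts om -> alive t om = (t < stop_time om)%N.
Proof.
move=> /stop_timeP[nT aT]; apply/idP/idP => [|/aT//].
by apply: contraTT; rewrite -leqNgt => /alive_le h; apply: contra nT; exact: h.
Qed.

Hypothesis k_gt0 : (0 < k)%N.

Lemma alive0 om : alive 0 om.
Proof. by rewrite /alive /hits big_ord0. Qed.

Lemma stop_time_gt0 om : halts om -> (0 < stop_time om)%N.
Proof. by move=> h; rewrite -alive_stop_time// alive0. Qed.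

Lemma hits_stop_time om : halts om -> hits (stop_time om) om = k.
Proof.
move=> h; have := alive_stop_time (stop_time om) h.
have := alive_stop_time (stop_time om).-1 h.
case: (stop_time om) (stop_time_gt0 h) => // T _ /=; rewrite ltnn ltnSn.
rewrite /alive hitsS => hk /negbT; rewrite -leqNgt => kh.
apply/eqP; rewrite eqn_leq kh andbT.
by apply: leq_trans hk; rewrite -addn1 leq_add2l leq_b1.
Qed.

Lemma stops_stop_time om t : stops t om -> halts om /\ stop_time om = t.+1.
Proof.
move=> /andP[at_ nt]; have h : halts om by exists t.+1.
split=> //; apply/eqP; rewrite eqn_leq leqNgt -!alive_stop_time//.
by rewrite nt at_.
Qed.

Lemma lifetime_halts om : halts om -> lifetime om = (stop_time om)%:R%:E.
Proof.
move=> h; rewrite /lifetime (nneseries_split 0 (stop_time om)); last first.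
  by move=> t _; rewrite lee_fin.
rewrite add0n eseries0 ?adde0; last first.
  by move=> t tT _; rewrite alive_stop_time// ltnNge tT.
rewrite sumEFin; congr EFin.
rewrite (eq_big_nat _ _ (F2 := fun=> 1)); last first.
  by move=> t /andP[_ tT]; rewrite alive_stop_time// tT.
by rewrite big_const_nat subn0 iter_addr_0.
Qed.

Lemma lifetime_loops om : ~ halts om -> lifetime om = +oo%E.
Proof.
move=> /haltsN h; apply/eqyP => A A0.
apply: (le_trans _ (nneseries_lim_ge (Num.trunc A).+1 _)); last first.
  by move=> t _ _; rewrite lee_fin.
rewrite sumEFin lee_fin.
rewrite (eq_big_nat _ _ (F2 := fun=> 1)); last by move=> t _; rewrite h.
by rewrite big_const_nat subn0 iter_addr_0 ltW// truncnS_gt.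
Qed.

(** The successes seen while the loop is running number min (hits, k). This is the pathwise half of
    Wald's argument. *)
Lemma sum_alive_hits om N : (\sum_(t < N) (alive t om && b t om) <= k)%N.
Proof.
suff : (\sum_(t < N) (alive t om && b t om) = minn (hits N om) k)%N.
  by move=> ->; exact: geq_minr.
elim: N => [|N IH]; first by rewrite big_ord0 /hits big_ord0 min0n.
rewrite big_ord_recr/= IH hitsS /alive.
case: ltnP => hk /=; last first.
  by rewrite addn0 !(minn_idPr _)// (leq_trans hk)// leq_addr.
symmetry; apply/minn_idPl.
by apply: leq_trans hk; rewrite -addn1 leq_add2l leq_b1.
Qed.

Variables p theta : R.
Hypothesis theta_lt1 : theta < 1.

Lemma gmart_ge0 t om : 0 <= gmart p theta t om.
Proof. by rewrite mulr_ge0 ?expR_ge0// exprn_ge0// subr_ge0 ltW. Qed.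

Lemma gmartS t om : gmart p theta t.+1 om =
  gmart p theta t om * (expR (theta * p * a t om) * (1 - theta) ^+ b t om).
Proof.
by rewrite /gmart clockS hitsS mulrDr expRD exprD; ring.
Qed.

Lemma stopped_gmart_ge0 om : (0 <= stopped_gmart p theta om)%E.
Proof.
by apply: nneseries_ge0 => t _ _; rewrite lee_fin mulr_ge0 ?gmart_ge0.
Qed.

Lemma stopped_gmart_halts om : halts om ->
  ((expR (theta * p * stop_clock om) * (1 - theta) ^+ k)%:E <=
   stopped_gmart p theta om)%E.
Proof.
move=> h; have T0 := stop_time_gt0 h; pose T := (stop_time om).-1.
have TE : stop_time om = T.+1 by rewrite /T prednK.
apply: (le_trans _ (nneseries_lim_ge T.+1 _)); last first.
  by move=> t _ _; rewrite lee_fin mulr_ge0 ?gmart_ge0.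
rewrite big_nat_recr//= -[leLHS]add0e; apply: leeD.
  by apply: sume_ge0 => t _; rewrite lee_fin mulr_ge0 ?gmart_ge0.
rewrite /gmart -TE hits_stop_time// /stops !alive_stop_time// TE ltnSn ltnn/=.
by rewrite mulr1 /stop_clock TE.
Qed.

End gbas_run.

(** * Measurability of the stopped walk *)

Section gbas_measurability.
Context (d : measure_display) (Om : measurableType d) (R : realType).
Variables (b : nat -> Om -> bool) (a : nat -> Om -> R) (k : nat).

Lemma measurable_natr (f : Om -> bool) : measurable_fun setT f ->
  measurable_fun setT (fun om => (f om)%:R : R).
Proof.
move=> mf; rewrite (_ : (fun om => _) = (fun om => if f om then 1 else 0)).
  exact: measurable_fun_ifT.
by apply/funext => om; case: (f om).
Qed.

Section past.
Variable t : nat.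
Hypothesis mb : forall u, (u < t)%N -> measurable_fun setT (b u).
Hypothesis ma : forall u, (u < t)%N -> measurable_fun setT (a u).

Lemma measurable_clock : measurable_fun setT (clock a t).
Proof.
elim: t ma => [|t' IH] ma'.
  rewrite (_ : clock _ _ = cst 0)//.
  by apply/funext => om; rewrite /clock big_ord0.
rewrite (_ : clock _ _ = fun om => clock a t' om + a t' om); last first.
  by apply/funext => om; rewrite clockS.
apply: measurable_funD; last exact: ma'.
by apply: IH => u ut; apply: ma'; exact: ltnW.
Qed.

Lemma measurable_hits : measurable_fun setT (fun om => (hits b t om)%:R : R).
Proof.
elim: t mb => [|t' IH] mb'.
  rewrite (_ : (fun om => _) = cst 0)//.
  by apply/funext => om; rewrite /hits big_ord0.
rewrite (_ : (fun om => _) = fun om => (hits b t' om)%:R + (b t' om)%:R); last first.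
  by apply/funext => om; rewrite hitsS natrD.
apply: measurable_funD; last exact/measurable_natr/mb'.
by apply: IH => u ut; apply: mb'; exact: ltnW.
Qed.

Lemma measurable_alive : measurable_fun setT (alive b k t).
Proof.
rewrite (_ : alive b k t = fun om => (hits b t om)%:R < (k%:R : R)); last first.
  by apply/funext => om; rewrite ltr_nat.
by apply: measurable_fun_ltr => //; exact: measurable_hits.
Qed.

Lemma measurable_expX (f : Om -> bool) (c : R) : measurable_fun setT f ->
  measurable_fun setT (fun om => c ^+ f om).
Proof.
move=> mf; rewrite (_ : (fun om => _) = (fun om => if f om then c else 1)).
  exact: measurable_fun_ifT.
by apply/funext => om; case: (f om).
Qed.

Lemma measurable_gmart p theta : measurable_fun setT (gmart b a p theta t).
Proof.
elim: t mb ma => [|t' IH] mb' ma'.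
  rewrite (_ : gmart _ _ _ _ _ = cst 1)//.
  by apply/funext => om; rewrite /gmart /hits /clock !big_ord0 mulr0 expR0 mulr1.
rewrite (_ : gmart _ _ _ _ _ = fun om => gmart b a p theta t' om *
   (expR (theta * p * a t' om) * (1 - theta) ^+ b t' om)); last first.
  by apply/funext => om; rewrite gmartS.
apply: measurable_funM.
  by apply: IH => u ut; [apply: mb'|apply: ma']; exact: ltnW.
apply: measurable_funM; last exact/measurable_expX/mb'.
by apply: measurableT_comp => //; apply: measurable_funM => //; exact: ma'.
Qed.

End past.

Hypothesis mb : forall u, measurable_fun setT (b u).
Hypothesis ma : forall u, measurable_fun setT (a u).

Lemma measurable_stops t : measurable_fun setT (stops b k t).
Proof.
by apply: measurable_and; [|apply: measurable_neg]; exact: measurable_alive.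
Qed.

Lemma measurable_stopped_gmart p theta : theta < 1 ->
  measurable_fun setT (stopped_gmart b a k p theta).
Proof.
move=> th1; apply: ge0_emeasurable_sum => t => [om _ _|_].
  by rewrite lee_fin mulr_ge0 ?gmart_ge0.
apply/measurable_EFinP/measurable_funM; first exact: measurable_gmart.
exact/measurable_natr/measurable_stops.
Qed.

Lemma measurable_lifetime : measurable_fun setT (lifetime R b k).
Proof.
apply: ge0_emeasurable_sum => t => [om _ _|_]; first by rewrite lee_fin.
exact/measurable_EFinP/measurable_natr/measurable_alive.
Qed.

Lemma measurable_set_alive t : measurable [set om | alive b k t om].
Proof.
have := @measurable_alive t (fun u _ => mb u) measurableT [set true] I.
by rewrite setTI; congr measurable; apply/seteqP; split=> om /=.
Qed.

Lemma measurable_halts : measurable [set om | halts b k om].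
Proof.
rewrite (_ : mkset _ = \bigcup_t ~` [set om | alive b k t om]).
  by apply: bigcupT_measurable => t; apply/measurableC/measurable_set_alive.
apply/seteqP; split=> om /=; first by move=> [t /negP nt]; exists t.
by move=> [t _ /negP nt]; exists t.
Qed.

(** For functions defined by a classical case distinction, such as the clock at the stop time: on
    each piece of a countable cover they agree with a function known to be measurable. *)
Lemma measurable_glue (d' : measure_display) (T : measurableType d') (J : Type)
    (A : J -> set Om) (f : Om -> T) (g : J -> Om -> T) :
  countable [set: J] -> (forall j, measurable (A j)) -> \bigcup_j A j = setT ->
  (forall j om, A j om -> f om = g j om) ->
  (forall j, measurable_fun setT (g j)) -> measurable_fun setT f.
Proof.
move=> cJ mA AT fg mg _ B mB; rewrite setTI.
rewrite (_ : f @^-1` B = \bigcup_j (A j `&` g j @^-1` B)).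
  apply: countable_bigcupT_measurable => // j; apply: measurableI => //.
  by rewrite -[X in measurable X]setTI; exact: mg.
apply/seteqP; split=> om /=.
  move=> fB; have : (\bigcup_j A j) om by rewrite AT.
  by move=> [j _ Aj]; exists j => //; split=> //=; rewrite -(fg _ _ Aj).
by move=> [j _ [Aj gB]]; rewrite (fg _ _ Aj).
Qed.

Lemma measurable_stop_clock : (0 < k)%N -> measurable_fun setT (stop_clock b a k).
Proof.
move=> k0.
(* One piece per possible last draw, and [None] for the runs that never halt, where the clock is
   0. *)
pose A (j : option nat) : set Om := if j is Some t then [set om | stops b k t om]
  else ~` [set om | halts b k om].
pose g (j : option nat) : Om -> R := if j is Some t then clock a t.+1 else cst 0.
apply: (@measurable_glue _ _ _ A _ g) => //.
- move=> [t|] /=; last exact/measurableC/measurable_halts.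
  have := @measurable_stops t measurableT [set true] I.
  by rewrite setTI; congr measurable; apply/seteqP; split=> om /=.
- apply/seteqP; split=> om // _; have [h|h] := pselect (halts b k om); last by exists None.
  exists (Some (stop_time b k om).-1) => //=; rewrite /stops !alive_stop_time//.
  by rewrite prednK ?stop_time_gt0// leqnn ltnn.
- move=> [t|] om /=; first by move=> sT; rewrite /stop_clock (stops_stop_time sT).2.
  by move=> h; rewrite /stop_clock /stop_time; case: pselect => // ?; rewrite /clock big_ord0.
- by move=> [t|]//=; apply: measurable_clock.
Qed.

End gbas_measurability.

(** * Martingale property, Wald bound and termination of the walk *)

Section gbas_law.
Context (d : measure_display) (Om : measurableType d) (R : realType).
Variables (P : probability Om R) (I : choiceType) (F : I -> set (set Om)).
Hypothesis F_measurable : forall i, F i `<=` measurable.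
Hypothesis F_setT : forall i, F i setT.
Hypothesis F_setI : forall i, setI_closed (F i).
Hypothesis F_indep : mutually_independent P F.
Variables (b : nat -> Om -> bool) (a : nat -> Om -> R) (cb ca : nat -> I).
Hypothesis cb_inj : injective cb.
Hypothesis ca_inj : injective ca.
Hypothesis cb_ca : forall t u, cb t != ca u.
Hypothesis b_cell : forall t A, F (cb t) (b t @^-1` A).
Hypothesis a_cell : forall t B, measurable B -> F (ca t) (a t @^-1` B).
Variables (k : nat) (p : R).
Hypothesis k_gt0 : (0 < k)%N.
Hypothesis p01 : 0 <= p <= 1.
Hypothesis b_law : forall t, P (b t @^-1` [set true]) = p%:E.
Hypothesis a_law : forall t B, measurable B ->
  P (a t @^-1` B) = exponential_prob 1 B.

Lemma block_b_measurable (S : set I) t : S (cb t) ->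
  measurable_fun setT (b t : block_space F S -> _).
Proof.
move=> St _ A mA; rewrite setTI.
by apply: block_cell_measurable; [|exact: St|exact: b_cell].
Qed.

Lemma block_a_measurable (S : set I) t : S (ca t) ->
  measurable_fun setT (a t : block_space F S -> _).
Proof.
move=> St _ A mA; rewrite setTI.
by apply: block_cell_measurable; [|exact: St|exact: a_cell].
Qed.

Let mb t : measurable_fun setT (b t).
Proof. by move=> _ A mA; rewrite setTI; apply: F_measurable; exact: b_cell. Qed.

Let ma t : measurable_fun setT (a t).
Proof. by move=> _ A mA; rewrite setTI; apply: F_measurable; exact: a_cell. Qed.

(** The cells read before draw t. They determine [gmart] and [alive] at time t and are disjoint from
    the cells of draw t itself. *)
Definition past t : set I :=
  [set i | exists2 u, (u < t)%N & i = cb u \/ i = ca u].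

Let past_cb t : past t `&` [set cb t] = set0.
Proof.
apply/seteqP; split=> // i [[u ut []->] /= /eqP].
  by rewrite (inj_eq cb_inj) => /eqP uE; rewrite uE ltnn in ut.
by rewrite eq_sym (negbTE (cb_ca _ _)).
Qed.

Let past_now t : past t `&` [set i | i = cb t \/ i = ca t] = set0.
Proof.
apply/seteqP; split=> // i [[u ut [] ->] /= []] /eqP.
- by rewrite (inj_eq cb_inj) => /eqP uE; rewrite uE ltnn in ut.
- by rewrite (negbTE (cb_ca _ _)).
- by rewrite eq_sym (negbTE (cb_ca _ _)).
- by rewrite (inj_eq ca_inj) => /eqP uE; rewrite uE ltnn in ut.
Qed.

Section mgf.
Variable theta : R.
Hypothesis theta_lt1 : theta < 1.

Let theta_p : theta * p < 1.
Proof.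
case/andP: p01 => p0 p1; have [t0|t0] := leP theta 0.
  by apply: le_lt_trans ltr01; rewrite mulr_le0_ge0.
by apply: le_lt_trans theta_lt1; rewrite ger_pMr.
Qed.

Let X1 : 0 <= 1 - theta.
Proof. by rewrite subr_ge0 ltW. Qed.

(** The exponential factor has mean 1 / (1 - theta p), the Bernoulli factor p (1 - theta) + (1 - p)
    = 1 - theta p. The p in the exponent is there to make them cancel. *)
Lemma integral_gmart_step t :
  (\int[P]_om (expR (theta * p * a t om) * (1 - theta) ^+ b t om)%:E = 1)%E.
Proof.
under eq_integral do rewrite EFinM.
rewrite (@integral_mul_blocks _ _ _ P I F F_measurable F_setT F_setI F_indep
  [set ca t] [set cb t]); first last.
- by move=> om; rewrite lee_fin exprn_ge0.
- by move=> om; rewrite lee_fin expR_ge0.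
- by apply/measurable_EFinP/measurable_expX; exact: block_b_measurable.
- apply/measurable_EFinP; apply: measurableT_comp => //.
  by apply: measurable_funM => //; exact: block_a_measurable.
- apply/seteqP; split=> // i [/= -> /eqP].
  by rewrite eq_sym (negbTE (cb_ca _ _)).
rewrite (exponential_mgf (ma t) (a_law t) theta_p).
have mbt : measurable (b t @^-1` [set true]).
  by rewrite -[X in measurable X]setTI; exact: mb.
rewrite (eq_integral (fun om => ((1 - theta) * \1_(b t @^-1` [set true]) om)%:E
   + (\1_(~` (b t @^-1` [set true])) om)%:E)%E); last first.
  move=> om _; rewrite -EFinD; congr EFin; rewrite !indicE in_setC.
  have [bt|bt] := boolP (b t om).
    by rewrite mem_set//= expr1 mulr1 addr0.
  by rewrite memNset//= ?expr0 ?mulr0 ?add0r// => /eqP; rewrite (negbTE bt).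
rewrite ge0_integralD//=; first last.
- by apply/measurable_EFinP/measurable_indic; exact: measurableC.
- by apply/measurable_EFinP/measurable_funM => //; exact: measurable_indic.
- by move=> om _; rewrite lee_fin mulr_ge0.
under eq_integral do rewrite EFinM.
rewrite ge0_integralZl//=; first last.
- by apply/measurable_EFinP/measurable_indic.
have -> : (\int[P]_om (\1_(b t @^-1` [set true]) om)%:E = p%:E)%E.
  by rewrite integral_indic_probability// b_law.
have -> : (\int[P]_om (\1_(~` (b t @^-1` [set true])) om)%:E = (1 - p)%:E)%E.
  rewrite integral_indic_probability; last exact: measurableC.
  by rewrite probability_setC// b_law.
rewrite -(EFinM (1 - theta) p) -EFinD -EFinM.
congr EFin; have tp : 1 - theta * p != 0 by rewrite gt_eqF// subr_gt0.
by field.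
Qed.

(** Whether the loop is alive at t is decided by earlier draws, so the factor of draw t splits off
    with mean 1. *)
Lemma integral_gmartS t :
  (\int[P]_om (gmart b a p theta t.+1 om * (alive b k t om)%:R)%:E =
   \int[P]_om (gmart b a p theta t om * (alive b k t om)%:R)%:E)%E.
Proof.
under eq_integral do rewrite gmartS mulrAC EFinM.
rewrite (@integral_mul_blocks _ _ _ P I F F_measurable F_setT F_setI F_indep
  (past t) [set i | i = cb t \/ i = ca t]) ?integral_gmart_step ?mule1//.
- apply/measurable_EFinP; apply: measurable_funM.
    apply: measurable_gmart => u ut.
      by apply: block_b_measurable; exists u => //; left.
    by apply: block_a_measurable; exists u => //; right.
  apply: measurable_natr; apply: (measurable_alive R) => u ut.
  by apply: block_b_measurable; exists u => //; left.
- apply/measurable_EFinP/measurable_funM.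
    apply: measurableT_comp => //; apply: measurable_funM => //.
    by apply: block_a_measurable; right.
  by apply: measurable_expX; apply: block_b_measurable; left.
- by move=> om; rewrite lee_fin mulr_ge0 ?gmart_ge0.
- by move=> om; rewrite lee_fin mulr_ge0 ?expR_ge0 ?exprn_ge0.
Qed.

(* [gmart] is a martingale, so optional stopping bounds its stopped value. *)
Lemma integral_stopped_gmart :
  (\int[P]_om stopped_gmart b a k p theta om <= 1)%E.
Proof.
have g0 t om : 0 <= gmart b a p theta t om by exact: gmart_ge0.
have mg t : measurable_fun setT (gmart b a p theta t).
  exact: measurable_gmart.
have malive t : measurable_fun setT (fun om => (alive b k t om)%:R : R).
  by apply: measurable_natr; exact: measurable_alive.
have mstops t : measurable_fun setT (fun om => (stops b k t om)%:R : R).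
  by apply: measurable_natr; exact: measurable_stops.
(* [V t] is the mass still running before draw t and [D t] the mass stopped by that draw.
   Telescoping from V 0 = 1 bounds every partial sum of [D] by 1. *)
pose V t := (\int[P]_om (gmart b a p theta t om * (alive b k t om)%:R)%:E)%E.
pose D t := (\int[P]_om (gmart b a p theta t.+1 om * (stops b k t om)%:R)%:E)%E.
have VD t : (V t = D t + V t.+1)%E.
  rewrite /V /D -integral_gmartS -ge0_integralD//; first last.
  - exact/measurable_EFinP/measurable_funM.
  - by move=> om _; rewrite lee_fin mulr_ge0.
  - exact/measurable_EFinP/measurable_funM.
  - by move=> om _; rewrite lee_fin mulr_ge0.
  apply: eq_integral => om _; rewrite -EFinD -mulrDr -natrD; congr (_ * _%:R)%:E.
  rewrite /stops; have := @aliveS _ b k t om.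
  by case: (alive b k t.+1 om) (alive b k t om) => [] [] //; case/(_ isT).
have V0 t : (0 <= V t)%E by apply: integral_ge0 => om _; rewrite lee_fin mulr_ge0.
have V01 : V 0 = 1%E.
  rewrite /V; under eq_integral do
    rewrite /gmart alive0// /clock /hits !big_ord0 mulr0 expR0 !mulr1.
  exact: integral_cst_probability.
have DN N : (\sum_(0 <= t < N) D t + V N = 1)%E.
  elim: N => [|N IH]; first by rewrite big_geq// add0e.
  by rewrite big_nat_recr//= -addeA -VD.
rewrite /stopped_gmart integral_nneseries//; first last.
- by move=> t om _; rewrite lee_fin mulr_ge0.
- by move=> t; exact/measurable_EFinP/measurable_funM.
apply: lime_le.
  apply: is_cvg_nneseries => t _ _; apply: integral_ge0 => om _.
  by rewrite lee_fin mulr_ge0.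
by apply: nearW => N; rewrite -(DN N) leeDl.
Qed.

End mgf.

(** Wald's argument: being alive at t is independent of draw t, so p P(alive t) is the probability
    of a success at t while alive, and at most k such successes occur. *)
Lemma integral_lifetime : (p%:E * \int[P]_om lifetime R b k om <= k%:R%:E)%E.
Proof.
have [p0 _] := andP p01.
have malive t : measurable_fun setT (fun om => (alive b k t om)%:R : R).
  by apply: measurable_natr; exact: measurable_alive.
have mbR t : measurable_fun setT (fun om => (b t om)%:R : R).
  exact: measurable_natr.
have mbt t : measurable (b t @^-1` [set true]).
  by rewrite -[X in measurable X]setTI; exact: mb.
rewrite /lifetime integral_nneseries//; last first.
  by move=> t; exact/measurable_EFinP.
rewrite -nneseriesZl; last by move=> t _; apply: integral_ge0 => om _; rewrite lee_fin.
have pE t : (p%:E * \int[P]_om ((alive b k t om)%:R)%:E =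
    \int[P]_om ((alive b k t om && b t om)%:R)%:E)%E.
  rewrite [RHS](eq_integral (fun om => ((alive b k t om)%:R)%:E * ((b t om)%:R)%:E)%E); last first.
    by move=> om _; rewrite -EFinM -natrM mulnb.
  rewrite (@integral_mul_blocks _ _ _ P I F F_measurable F_setT F_setI F_indep
    (past t) [set cb t])//.
  - rewrite muleC; congr (_ * _)%E.
    rewrite -(b_law t) -integral_indic_probability//.
    apply: eq_integral => om _; rewrite indicE; congr ((nat_of_bool _)%:R)%:E.
    by case E: (b t om); [apply: mem_set|apply: memNset => /=; rewrite E].
  - apply/measurable_EFinP/measurable_natr; apply: (measurable_alive R) => u ut.
    by apply: block_b_measurable; exists u => //; left.
  - by apply/measurable_EFinP/measurable_natr; exact: block_b_measurable.
rewrite (eq_eseriesr (fun t _ => pE t)).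
apply: lime_le.
  apply: is_cvg_nneseries => t _ _; apply: integral_ge0 => om _.
  by rewrite lee_fin.
apply: nearW => N.
have mab t : measurable_fun setT (fun om => (alive b k t om && b t om)%:R : R).
  by apply: measurable_natr; apply: measurable_and => //; exact: measurable_alive.
rewrite -ge0_integral_sum//; last by move=> t; exact/measurable_EFinP.
apply: (@le_trans _ _ (\int[P]_om (cst k%:R%:E om))%E); last first.
  by rewrite integral_cst_probability.
apply: ge0_le_integral => //.
- by move=> om _; apply: sume_ge0 => t _; rewrite lee_fin.
- by apply: emeasurable_sum => t; exact/measurable_EFinP.
- move=> om _; rewrite sumEFin lee_fin -natr_sum ler_nat big_mkord.
  exact: sum_alive_hits.
Qed.

(** The lifetime is infinite on runs that never halt, yet has finite mean when p > 0. *)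
Lemma halts_almost_surely : 0 < p -> P (~` [set om | halts b k om]) = 0%E.
Proof.
move=> p0; set N := ~` _.
have mN : measurable N by apply/measurableC/measurable_halts.
have fin : (\int[P]_om lifetime R b k om < +oo)%E.
  rewrite ltNge leye_eq; apply/negP => /eqP E; have := integral_lifetime.
  by rewrite E gt0_muley ?lte_fin// leye_eq.
apply/eqP; rewrite -measure_le0 leNgt; apply/negP => PN.
suff : (+oo <= \int[P]_om lifetime R b k om)%E by rewrite leNgt fin.
apply: (@le_trans _ _ (\int[P]_(om in N) cst +oo%E om)%E).
  by rewrite integral_cst// gt0_mulye.
apply: (@le_trans _ _ (\int[P]_(om in N) lifetime R b k om)%E).
  rewrite le_eqVlt; apply/orP; left; apply/eqP; apply: eq_integral => om.
  by rewrite inE => h; rewrite (@lifetime_loops _ R _ _ _ h).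
apply: ge0_subset_integral => //.
- exact: measurable_lifetime.
- by move=> om _; apply: nneseries_ge0 => t _ _; rewrite lee_fin.
Qed.

End gbas_law.

(** * Deterministic bounds *)

Section deterministic_bounds.
Variable R : realType.
Implicit Types (t D e x y : R).

(** Above, the product is at most exp D <= 1 / (1 - D) = 1 + t. Below, [expR_sub_sqr_le] costs the
    sum of squares, at most D^2 <= t D, and 1 - D - t D = 1 - t. *)
Lemma prod_near_one n (g : 'I_n -> R) t D e : 0 < t <= 2^-1 -> D = t / (1 + t) ->
  e ^+ 2 * n%:R <= D ^+ 2 -> e <= 3^-1 ->
  (forall i, `|g i - 1| <= e) -> `|\sum_i (g i - 1)| <= D ->
  `|1 - \prod_i g i| <= t.
Proof.
move=> /andP[t0 t2] DE eD e3 ge gD.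
have t1 : 0 < 1 + t by lra.
have D0 : 0 < D by rewrite DE divr_gt0.
have tDE : t = D + t * D by rewrite DE; field; lra.
have ui i : - e <= g i - 1 <= e by rewrite -ler_norml.
have u2 i : (g i - 1) ^+ 2 <= e ^+ 2.
  have : 0 <= (e - (g i - 1)) * (e + (g i - 1)).
    by apply: mulr_ge0; have := ui i; lra.
  by have := ui i; lra.
have /andP[gD1 gD2] : - D <= \sum_i (g i - 1) <= D by rewrite -ler_norml.
have gpos i : 0 <= g i by have := ui i; lra.
rewrite distrC ler_norml; apply/andP; split.
  have h : expR (\sum_i (g i - 1 - (g i - 1) ^+ 2)) <= \prod_i g i.
    rewrite expR_sum; apply: ler_prod => i _; rewrite expR_ge0/=.
    apply: (le_trans (@expR_sub_sqr_le _ _ _)); last by rewrite addrC subrK.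
    have := ui i; lra.
  have h2 : - D - D ^+ 2 <= \sum_i (g i - 1 - (g i - 1) ^+ 2).
    rewrite sumrB; apply: lerB => //.
    apply: (le_trans (ler_sum _ (fun i _ => u2 i))).
    by rewrite sumr_const card_ord -mulr_natr.
  have h3 : 1 + (- D - D ^+ 2) <= \prod_i g i.
    apply: le_trans h; apply: (le_trans (expR_ge1Dx _)).
    by rewrite ler_expR.
  have : D ^+ 2 <= t * D by rewrite expr2 ler_pM2r// DE ler_pdivrMr//; nra.
  lra.
have h : \prod_i g i <= expR (\sum_i (g i - 1)).
  rewrite expR_sum; apply: ler_prod => i _; rewrite gpos/=.
  by apply: le_trans (expR_ge1Dx _); rewrite addrC subrK.
have h2 : expR (\sum_i (g i - 1)) <= expR D by rewrite ler_expR.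
have h3 : expR D <= 1 + t.
  have -> : 1 + t = (1 - D)^-1 by rewrite DE; field; apply/andP; split; lra.
  have D1 : 0 < 1 - D by rewrite DE subr_gt0 ltr_pdivrMr//; lra.
  rewrite -[D]opprK expRN lef_pV2 ?posrE ?expR_gt0//.
  by apply: (le_trans _ (expR_ge1Dx _)); lra.
all: by lra.
Qed.

(** With z = W / G and q = G / V the terms are max (0, 1 - z q) and max (0, 1 - z). The factor q
    matters only while one of them is positive, which keeps the difference below |1 - q| however
    large z is. *)
Lemma dist_max0_le (W G V : R) : 0 <= W -> 0 < G -> V != 0 -> 0 <= G / V ->
  `|Num.max 0 (1 - W / V) - Num.max 0 (1 - W / G)| <= `|1 - G / V|.
Proof.
move=> W0 G0 V0; set q := G / V => q0.
have -> : W / V = W / G * q by rewrite /q; field; rewrite V0 gt_eqF.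
set z := W / G; have z0 : 0 <= z by rewrite divr_ge0// ltW.
have [q1|q1] := leP q 1.
  rewrite (@ger0_norm _ (1 - q)) ?subr_ge0//.
  by rewrite /Num.max; do 2 case: ltP => ?; rewrite ler_norml; apply/andP; split; nra.
rewrite (@ltr0_norm _ (1 - q)) ?subr_lt0// opprB.
by rewrite /Num.max; do 2 case: ltP => ?; rewrite ler_norml; apply/andP; split; nra.
Qed.

(* The constant 3.69 is what the choice of [k] in Est provides: 3 * 1.11^2 > 3.69. *)
Lemma chernoff_upper_value (m k : nat) (e L : R) : 0 <= e <= 3^-1 ->
  m%:R * e <= 3^-1 -> 369 / 100 * L <= m%:R * k%:R * e ^+ 2 -> 7 / 2 <= L ->
  expR (- (e / (1 + e) * (m%:R * (k%:R - 1) * (1 + e)))) *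
    ((1 - e / (1 + e)) ^+ (m * k))^-1 <= expR (- L) / 2.
Proof.
move=> /andP[e0 e3] me mke L7.
(* [e / (1 + e)] is the optimal parameter for the threshold m k (1 + e). Having k - 1 in place of k
   costs m e <= 1/3 in the exponent. *)
have -> : 1 - e / (1 + e) = (1 + e)^-1 by field; lra.
rewrite -exprVn invrK.
have -> : e / (1 + e) * (m%:R * (k%:R - 1) * (1 + e)) = m%:R * (k%:R - 1) * e.
  by field; lra.
apply: (@le_trans _ _ (expR (- (m%:R * (k%:R - 1) * e)) *
    expR (e - 3 / 8 * e ^+ 2) ^+ (m * k))).
  rewrite ler_pM2l ?expR_gt0//; apply: lerXn2r; rewrite ?nnegrE ?expR_ge0 ?addr_ge0//.
  by apply: ge1D_le_expR; rewrite e0 e3.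
rewrite -expRM_natl -expRD natrM.
(* The exponent is at most 1/3 - 3/8 * 3.69 L, which is below -L - 1 as soon as L >= 7/2; then exp
   (-1) <= 1/2 provides the factor for a two-sided bound. *)
apply: (@le_trans _ _ (expR (- L - 1))); first by rewrite ler_expR; lra.
rewrite expRD ler_pM2l ?expR_gt0// expRN lef_pV2 ?posrE ?expR_gt0//.
by apply: le_trans (expR_ge1Dx _); lra.
Qed.

(** l = 4/5 e minimises the expression -l e + 5/8 l^2 left by [expR_le_ge1D], with value -2/5 e^2.
    On this side the shift from k to k - 1 helps the bound. *)
Lemma chernoff_lower_value (m k : nat) (e L : R) : (0 < k)%N -> 0 <= e <= 3^-1 ->
  369 / 100 * L <= m%:R * k%:R * e ^+ 2 -> 7 / 2 <= L ->
  expR (- (- (4 / 5 * e) * (m%:R * (k%:R - 1) * (1 - e)))) *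
    ((1 - (- (4 / 5 * e))) ^+ (m * k))^-1 <= expR (- L) / 2.
Proof.
move=> k0 /andP[e0 e3] mke L7; set l := 4 / 5 * e.
have l0 : 0 <= l <= 3^-1 by rewrite /l; lra.
rewrite opprK mulNr opprK.
apply: (@le_trans _ _ (expR (l * (m%:R * (k%:R - 1) * (1 - e))) *
    (expR (l - 5 / 8 * l ^+ 2) ^+ (m * k))^-1)).
  rewrite ler_pM2l ?expR_gt0// lef_pV2 ?posrE ?exprn_gt0 ?expR_gt0//; last by lra.
  by apply: lerXn2r; rewrite ?nnegrE ?expR_ge0 ?addr_ge0 ?expR_le_ge1D//; lra.
rewrite -expRM_natl -expRN -expRD natrM.
apply: (@le_trans _ _ (expR (- L - 1))).
  rewrite ler_expR.
  have h : 0 <= m%:R * (l * (1 - e)) :> R by rewrite !mulr_ge0// /l; lra.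
  have -> : l * (m%:R * (k%:R - 1) * (1 - e)) - m%:R * k%:R * (l - 5 / 8 * l ^+ 2) =
    - (2 / 5) * (m%:R * k%:R * e ^+ 2) - m%:R * (l * (1 - e)) by rewrite /l; field.
  lra.
rewrite expRD ler_pM2l ?expR_gt0// expRN lef_pV2 ?posrE ?expR_gt0//.
by apply: le_trans (expR_ge1Dx _); lra.
Qed.

(** Convexity of exp from its tangent at l z: after division by exp (l z), the lower bounds (1 - z)
    (1 - l z) + z (1 + l - l z) add up to 1. *)
Lemma expR_le_chord (l z : R) : 0 <= z <= 1 -> expR (l * z) <= 1 - z + z * expR l.
Proof.
move=> /andP[z0 z1].
have h1 := expR_ge1Dx (- (l * z)); have h2 := expR_ge1Dx (l - l * z).
have -> : expR l = expR (l * z) * expR (l - l * z).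
  by rewrite -expRD addrC subrK.
have := expRxMexpNx_1 (l * z).
set A := expR (l * z); set B := expR (- _) in h1 *; set C := expR (l - _) in h2 *.
move=> AB.
have -> : 1 - z + z * (A * C) = A * ((1 - z) * B + z * C).
  by transitivity ((1 - z) * (A * B) + z * (A * C)); [rewrite AB; ring|ring].
by rewrite ler_peMr ?expR_ge0//; nra.
Qed.

End deterministic_bounds.

(** * Composition of runs and their sample counts *)

Section outcomes.
Variable R : realType.

Lemma nsamples_ge0 T (c : outcome T) : (0 <= nsamples R c)%E.
Proof. by case: c => [[v N]|]//=; rewrite lee_fin. Qed.

Lemma nsamples_run_seq T (cs : seq (outcome T)) :
  nsamples R (run_seq cs) = (\sum_(c <- cs) nsamples R c)%E.
Proof.
elim: cs => [|c cs IH]; first by rewrite big_nil.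
rewrite big_cons -IH /=; case: c => [[v N]|] /=; last first.
  by rewrite addye// gt_eqF// (lt_le_trans _ (nsamples_ge0 _)).
case: (run_seq cs) => [[vs M]|] /=; first by rewrite natrD EFinD.
by rewrite addey.
Qed.

Lemma run_seq_Some (I : eqType) T (f : I -> outcome T) (v : I -> T)
    (N : I -> nat) (s : seq I) :
  (forall i, i \in s -> f i = Some (v i, N i)) ->
  run_seq (map f s) = Some (map v s, \sum_(i <- s) N i)%N.
Proof.
elim: s => [|i s IH] fE; first by rewrite big_nil.
rewrite /= fE ?mem_head// IH ?big_cons// => j js.
by apply: fE; rewrite in_cons js orbT.
Qed.

Lemma run_seq_inv (I : eqType) T (f : I -> outcome T) (s : seq I) r :
  run_seq (map f s) = Some r -> forall i, i \in s -> f i <> None.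
Proof.
elim: s r => //= j s IH r; case fj: (f j) => [[v N]|]//.
case rs: (run_seq _) => [[vs M]|]// _ i; rewrite in_cons => /predU1P[->|].
  by rewrite fj.
exact: IH rs i.
Qed.

End outcomes.

(** * GBAS as the stopped walk *)

Section gbas_as_run.
Context (R : realType) (Om : Type) (n : nat).
Variables (w : nat -> Om -> n.-tuple bool) (a : nat -> Om -> R).
Variables (i : 'I_n) (h : bool) (k : nat) (om : Om).

Let b t om := tnth (w t om) i == h.

Lemma gbas_stateE t :
  gbas_state (fun t => w t om) (fun t => a t om) i h t = (hits b t om, clock a t om).
Proof.
elim: t => [|t IH]; first by rewrite /hits /clock !big_ord0.
by rewrite /= IH hitsS clockS.
Qed.

Lemma gbasE : gbas (fun t => w t om) (fun t => a t om) i k h =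
  if pselect (halts b k om) then
    Some ((k%:R - 1) / stop_clock b a k om, stop_time b k om) else None.
Proof.
rewrite /gbas; case: pselect => [h1|h1]; case: pselect => h2 //=; last 2 first.
- by case: h2; move: h1 => [t]; rewrite gbas_stateE; exists t.
- by case: h1; move: h2 => [t ht]; exists t; rewrite gbas_stateE.
have -> : ex_minn h1 = stop_time b k om.
  have [nT aT] := stop_timeP h2; case: ex_minnP => T; rewrite gbas_stateE => nT' minT.
  apply/eqP; rewrite eqn_leq; apply/andP; split.
    by apply: minT; rewrite gbas_stateE.
  by rewrite leqNgt; apply/negP => /aT; rewrite /alive (negbTE nT').
by rewrite gbas_stateE.
Qed.

End gbas_as_run.

(** * Total variation distance and conditional bit probabilities *)

Section sampler_facts.
Context (R : realType) (m n : nat).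
Implicit Types (G W : sampler R m n) (psi : m.-tuple bool) (y z : n.-tuple bool).

Lemma setprob_ge0 G psi A : 0 <= setprob G psi A.
Proof. by apply: sumr_ge0 => x _; exact: outdist_ge0. Qed.

Lemma dTVE G W psi : dTV G W psi = \sum_y Num.max 0 (G psi y - W psi y).
Proof.
apply/eqP; rewrite eq_le; apply/andP; split.
  rewrite /dTV; elim/big_ind: _ => [|u v hu hv|A _].
  - by apply: sumr_ge0 => y _; rewrite le_max lexx.
  - by rewrite ge_max hu hv.
  - rewrite /setprob -sumrB big_mkcond/=; apply: ler_sum => y _.
    by case: ifP => _; rewrite le_max lexx ?orbT.
pose A : {set n.-tuple bool} := [set y | W psi y <= G psi y]%SET.
apply: (@le_trans _ _ (setprob G psi A - setprob W psi A)).
  rewrite /setprob -sumrB [leRHS]big_mkcond/=; apply: ler_sum => y _.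
  rewrite inE; case: ifPn => [h|]; first by rewrite max_r ?subr_ge0.
  by rewrite -ltNge => h; rewrite max_l// subr_le0 ltW.
by rewrite /dTV (bigD1 A)//= le_max lexx.
Qed.

Variables (G : sampler R m n) (SubCond : m.-tuple bool -> seq bool -> m.-tuple bool).
Hypothesis G_cond : is_subcond G SubCond.
Variables (psi : m.-tuple bool).

Definition prefix_prob y (i : nat) : R := setprob G psi (subcube n (take i y)).

(** Taken from the sampler on the input actually queried, so it is the success probability of a draw
    of GBAS even when the prefix has probability 0. *)
Definition bit_prob y (i : 'I_n) : R :=
  \sum_(z | tnth z i == tnth y i) G (SubCond psi (take i y)) z.

Lemma prefix_take_bit y z (i : 'I_n) :
  prefix (take i.+1 y) z = prefix (take i y) z && (tnth z i == tnth y i).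
Proof.
have iy : (i < size y)%N by rewrite size_tuple.
have iz : (i < size z)%N by rewrite size_tuple.
rewrite !prefixE (size_takel (ltnW iy)) (size_takel iy).
rewrite (take_nth false iy) (take_nth false iz) eqseq_rcons.
by rewrite !(tnth_nth false).
Qed.

Lemma prefix_prob_ge y i : G psi y <= prefix_prob y i.
Proof.
rewrite /prefix_prob /setprob (bigD1 y)/= ?lerDl; last by rewrite inE prefix_take.
by apply: sumr_ge0 => z _; exact: outdist_ge0.
Qed.

Lemma prefix_prob0 y : prefix_prob y 0 = 1.
Proof.
rewrite /prefix_prob take0 -(outdist_sum1 G psi) /setprob; apply: eq_bigl => z.
by rewrite inE prefix0s.
Qed.

Lemma prefix_probn y : prefix_prob y n = G psi y.
Proof.
rewrite /prefix_prob /setprob take_oversize ?size_tuple// (big_pred1 y)// => z.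
by rewrite inE prefixE size_tuple take_oversize ?size_tuple.
Qed.

(** A nonzero prefix probability rules out the uniform convention of [conddist]. The resulting
    ratios telescope along the string. *)
Lemma bit_probE y (i : 'I_n) : prefix_prob y i != 0 ->
  bit_prob y i = prefix_prob y i.+1 / prefix_prob y i.
Proof.
move=> q0; rewrite /bit_prob /prefix_prob {1}/setprob mulr_suml.
rewrite big_mkcond [RHS]big_mkcond/=; apply: eq_bigr => z _.
rewrite G_cond; last by rewrite size_take size_tuple ltn_ord ltnW.
rewrite /conddist !inE prefix_take_bit (negbTE q0).
by case: (tnth z i == _) => /=; rewrite ?andbT ?andbF//; case: ifP.
Qed.

Lemma bit_prob_ge0 y i : 0 <= bit_prob y i.
Proof. by apply: sumr_ge0 => z _; exact: outdist_ge0. Qed.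

Lemma bit_prob_le1 y i : bit_prob y i <= 1.
Proof.
rewrite /bit_prob -(outdist_sum1 G (SubCond psi (take i y))) big_mkcond/=.
by apply: ler_sum => z _; case: ifP => // _; exact: outdist_ge0.
Qed.

Section support.
Variable y : n.-tuple bool.
Hypothesis Gy : 0 < G psi y.

Lemma prefix_prob_gt0 i : 0 < prefix_prob y i.
Proof. exact: lt_le_trans (prefix_prob_ge y i). Qed.

Lemma bit_prob_gt0 i : 0 < bit_prob y i.
Proof. by rewrite bit_probE ?divr_gt0 ?gt_eqF ?prefix_prob_gt0. Qed.

Lemma prod_bit_prob : \prod_i bit_prob y i = G psi y.
Proof.
have H j : (j <= n)%N -> \prod_(i < n | (i < j)%N) bit_prob y i = prefix_prob y j.
  elim: j => [_|j IH jn]; first by rewrite prefix_prob0 big_pred0.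
  rewrite (bigD1 (Ordinal jn))//= bit_probE ?gt_eqF ?prefix_prob_gt0//=.
  rewrite (eq_bigl (fun i : 'I_n => (i < j)%N)); last first.
    by move=> i; rewrite -val_eqE/= ltnS ltn_neqAle andbC.
  by rewrite IH 1?ltnW// divfK// gt_eqF// prefix_prob_gt0.
rewrite -prefix_probn -(H n)//; apply: eq_bigl => i.
by rewrite ltn_ord.
Qed.

End support.

(* For either value of bit [i], the terms sharing their first [i] bits add up to
   at most the probability of that prefix. *)
Lemma sum_div_bit_prob i :
  \sum_(y | 0 < G psi y) G psi y / bit_prob y i <= 2.
Proof.
pose prv (h : bool) y : R := if tnth y i == h then G psi y / bit_prob y i else 0.
have -> : \sum_(y | 0 < G psi y) G psi y / bit_prob y i =
  \sum_(h : bool) \sum_(y | 0 < G psi y) prv h y.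
  rewrite exchange_big/=; apply: eq_bigr => y _.
  rewrite (bigD1 (tnth y i))//= /prv eqxx big1 ?addr0// => h.
  by rewrite eq_sym => /negbTE ->.
suff H h : \sum_(y | 0 < G psi y) prv h y <= 1.
  by apply: (le_trans (ler_sum _ (fun h _ => H h))); rewrite sumr_const card_bool.
have tks y : size (take i y) == i.
  by rewrite size_takel// size_tuple ltnW.
pose tk y : i.-tuple bool := Tuple (tks y).
rewrite (partition_big tk xpredT)//=.
pose q (u : i.-tuple bool) : R := setprob G psi (subcube n u).
have q1 : \sum_u q u = 1.
  rewrite -(outdist_sum1 G psi) /q /setprob.
  rewrite (partition_big tk xpredT)//=; apply: eq_bigr => u _; apply: eq_bigl => y.
  rewrite inE prefixE size_tuple -val_eqE/=.
  by apply/eqP/eqP.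
rewrite -q1; apply: ler_sum => u _.
have [q0|q0] := eqVneq (q u) 0.
  rewrite q0 big1// => y /andP[Gy /eqP uE].
  suff : 0 < q u by rewrite q0 ltxx.
  have -> : q u = prefix_prob y i by rewrite /q -uE.
  exact: prefix_prob_gt0.
have qge0 : 0 < q u by rewrite lt_neqAle eq_sym q0 setprob_ge0.
(* [q'] is the mass of the prefix [u] followed by the bit [h]. On this class the bit probability is
   the constant q' / q u, so the class contributes at most q' / (q' / q u) = q u, and the q u add up
   to 1. *)
pose q' : R := \sum_(y : n.-tuple bool | (take i y == u) && (tnth y i == h)) G psi y.
have bE y : 0 < G psi y -> tk y = u -> tnth y i = h -> bit_prob y i = q' / q u.
  move=> Gy uE hE; rewrite bit_probE ?gt_eqF ?prefix_prob_gt0//; congr (_ / _).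
    rewrite /prefix_prob /setprob; apply: eq_bigl => z.
    rewrite inE prefix_take_bit hE -uE/= prefixE size_takel ?size_tuple 1?ltnW//.
  by rewrite /prefix_prob /q -uE.
have [q'0|q'0] := eqVneq q' 0.
  rewrite big1 ?setprob_ge0// => y /andP[Gy /eqP uE]; rewrite /prv.
  case: eqP => // hE; have := bit_prob_gt0 Gy i.
  by rewrite bE// q'0 mul0r ltxx.
have q'ge0 : 0 < q'.
  rewrite lt_neqAle eq_sym q'0/=; apply: sumr_ge0 => y _; exact: outdist_ge0.
apply: (@le_trans _ _ (\sum_(y : n.-tuple bool |
  (take i y == u) && (tnth y i == h)) G psi y / (q' / q u))).
  rewrite [leLHS]big_mkcond [leRHS]big_mkcond/=; apply: ler_sum => y _.
  have -> : (tk y == u) = (take i y == u) by rewrite -val_eqE.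
  case: eqP => [uE|_] /=; last by rewrite andbF.
  rewrite andbT /prv; case: (tnth y i =P h) => [hE|_]; last by case: ifP.
  case: ifPn => [Gy|_]; first by rewrite bE//; apply: val_inj.
  by rewrite divr_ge0 ?outdist_ge0 ?divr_ge0// ltW.
rewrite -mulr_suml -/q' invf_div mulrA mulrAC divff// mul1r.
exact: lexx.
Qed.

End sampler_facts.

(** * Finite-valued random variables, Markov's inequality and union bounds *)

Section finite_random_variables.
Context (d : measure_display) (Om : measurableType d) (R : realType).
Variables (P : probability Om R) (T : finType) (X : Om -> T).
Hypothesis mX : forall z, measurable (X @^-1` [set z]).

Lemma measurable_set_bool (f : Om -> bool) :
  measurable_fun setT f -> measurable [set om | f om].
Proof.
move=> mf; have := mf measurableT [set true] I.
by rewrite setTI; congr measurable; apply/seteqP; split=> om /=.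
Qed.

Lemma measurable_finite_comp (d' : measure_display) (T' : measurableType d')
    (h : T -> Om -> T') :
  (forall z, measurable_fun setT (h z)) ->
  measurable_fun setT (fun om => h (X om) om).
Proof.
move=> mh; apply: (@measurable_glue _ _ _ _ T (fun z => X @^-1` [set z]) _ h) => //.
- by apply/seteqP; split=> om // _; exists (X om).
- by move=> z om /= <-.
Qed.

Lemma integral_finite_split (h : T -> Om -> \bar R) :
  (forall z, measurable_fun setT (h z)) -> (forall z om, 0 <= h z om)%E ->
  (\int[P]_om h (X om) om =
   \sum_z \int[P]_om ((\1_(X @^-1` [set z]) om)%:E * h z om))%E.
Proof.
move=> mh h0; rewrite -ge0_integral_sum//; last 2 first.
- move=> z; apply: emeasurable_funM => //.
  exact/measurable_EFinP/measurable_indic.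
- by move=> z om _; rewrite mule_ge0// lee_fin.
apply: eq_integral => om _; rewrite (bigD1 (X om))//= big1 ?adde0.
  by rewrite indicE mem_set// mul1e.
move=> z zX; rewrite indicE memNset ?mul0e//= => /esym/eqP.
by rewrite (negbTE zX).
Qed.

Lemma probability_finite_pred (f : T -> R) (Q : pred T) :
  (forall z, P (X @^-1` [set z]) = (f z)%:E) ->
  P [set om | Q (X om)] = (\sum_(z | Q z) f z)%:E.
Proof.
move=> Pf.
have mQ : measurable [set om | Q (X om)].
  rewrite (_ : mkset _ = \bigcup_(z in [set z | Q z]) X @^-1` [set z]).
    by apply: fin_bigcup_measurable.
  by apply/seteqP; split=> om /= => [q|[z /= q ->]//]; exists (X om).
rewrite -integral_indic_probability//.
rewrite (eq_integral (fun om => ((Q (X om))%:R)%:E)); last first.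
  move=> om _; rewrite indicE; congr ((nat_of_bool _)%:R)%:E.
  by case q: (Q (X om)); [apply: mem_set|apply: memNset => /=; rewrite q].
rewrite (@integral_finite_split (fun z _ => ((Q z)%:R)%:E))//.
rewrite -sumEFin [RHS]big_mkcond/=; apply: eq_bigr => z _.
rewrite ge0_integralZr//; last exact/measurable_EFinP/measurable_indic.
rewrite integral_indic_probability// Pf.
by case: (Q z); rewrite ?mule1 ?mule0.
Qed.

(** Markov's inequality for a variable of mean at most 1; both the Hoeffding and the Chernoff tails
    go through it. *)
Lemma expR_chernoff (Y : Om -> \bar R) (A : set Om) (v : R) :
  measurable_fun setT Y -> (forall om, 0 <= Y om)%E -> measurable A -> 0 < v ->
  (forall om, A om -> v%:E <= Y om)%E -> (\int[P]_om Y om <= 1)%E ->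
  (P A <= (v^-1)%:E)%E.
Proof.
move=> mY Y0 mA v0 AY Y1.
have : (v%:E * P A <= 1)%E.
  apply: le_trans Y1; rewrite -integral_indic_probability// -ge0_integralZl//; last 2 first.
  - exact/measurable_EFinP/measurable_indic.
  - by rewrite lee_fin ltW.
  apply: ge0_le_integral => //.
  - by move=> om _; rewrite mule_ge0// lee_fin// ltW.
  - by apply: emeasurable_funM => //; exact/measurable_EFinP/measurable_indic.
  - move=> om _; rewrite indicE; case: (boolP (om \in A)) => [|_].
      by rewrite inE => /AY; rewrite mule1.
    by rewrite mule0.
rewrite -(fineK (fin_num_measure P A mA)) -EFinM !lee_fin => h.
by rewrite -[v^-1]mul1r ler_pdivlMr// mulrC.
Qed.

End finite_random_variables.

Lemma probabilityU_le (d : measure_display) (Om : measurableType d)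
    (R : realType) (P : probability Om R) (A B : set Om) :
  measurable A -> measurable B -> (P (A `|` B) <= P A + P B)%E.
Proof. by move=> mA mB; exact: measureU2. Qed.

Lemma probability_bigU_le (d : measure_display) (Om : measurableType d)
    (R : realType) (P : probability Om R) (I : Type) (s : seq I) (A : I -> set Om) :
  (forall i, measurable (A i)) ->
  (P (\big[setU/set0]_(i <- s) A i) <= \sum_(i <- s) P (A i))%E.
Proof.
move=> mA; elim: s => [|i s IH]; first by rewrite !big_nil measure0.
rewrite !big_cons; apply: (le_trans (probabilityU_le _ _ _)) => //.
  exact: bigsetU_measurable.
by rewrite leeD2l.
Qed.

(** * Laws of the random tapes *)

Section tapes_law.
Context (d : measure_display) (Om : measurableType d) (R : realType).
Variables (P : probability Om R) (m n : nat).
Variables (x : nat -> Om -> n.-tuple bool).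
Variables (w : nat -> 'I_n -> nat -> m.-tuple bool -> Om -> n.-tuple bool).
Variables (a : nat -> 'I_n -> nat -> Om -> R).
Variables (G : sampler R m n) (SubCond : m.-tuple bool -> seq bool -> m.-tuple bool).
Variable psi : m.-tuple bool.
Hypothesis G_cond : is_subcond G SubCond.
Hypothesis tapes : random_tapes P x w a G psi.

Local Notation cell := (tape_cell m n).
Local Notation F := (tape_events x w a).
Local Notation p := (bit_prob G SubCond psi).

Lemma tape_events_setT c : F c setT.
Proof.
case: c => [[j|[[[j i] t] phi]]|[[j i] t]] /=; exists setT => //.
Qed.

Lemma tape_events_setI c : setI_closed (F c).
Proof.
case: c => [[j|[[[j i] t] phi]]|[[j i] t]] _ _ [A mA <-] [B mB <-].
- by exists (A `&` B) => //; rewrite preimage_setI.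
- by exists (A `&` B) => //; rewrite preimage_setI.
- by exists (A `&` B); [exact: measurableI|rewrite preimage_setI].
Qed.

Let F_m := tape_measurable tapes.
Let F_i := tape_indep tapes.

Lemma integral_mul_tapes (S1 S2 : set cell) (f g : Om -> \bar R) :
  S1 `&` S2 = set0 ->
  measurable_fun setT (f : block_space F S1 -> _) ->
  measurable_fun setT (g : block_space F S2 -> _) ->
  (forall om, 0 <= f om)%E -> (forall om, 0 <= g om)%E ->
  (\int[P]_om (f om * g om) = (\int[P]_om f om) * (\int[P]_om g om))%E.
Proof.
move=> S12 mf mg f0 g0.
exact (@integral_mul_blocks _ _ _ P _ F F_m tape_events_setT tape_events_setI
  F_i S1 S2 S12 f g mf mg f0 g0).
Qed.

Lemma block_fun_measurable (d' : measure_display) (T : measurableType d')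
    (S : set cell) (f : Om -> T) :
  measurable_fun setT (f : block_space F S -> T) -> measurable_fun setT f.
Proof.
move=> mf _ B mB; rewrite setTI; apply: (block_space_measurable F_m (S := S)).
by have := mf measurableT B mB; rewrite setTI.
Qed.

Lemma x_measurable (S : set cell) j : S (inl (inl j)) ->
  forall A, @measurable _ (block_space F S) (x j @^-1` A).
Proof.
move=> Sj A; apply: (block_cell_measurable tape_events_setT Sj).
by exists A.
Qed.

Lemma x_set1_measurable j z : measurable (x j @^-1` [set z]).
Proof.
apply: (block_space_measurable F_m (S := setT)).
exact: x_measurable.
Qed.

(** Conditioning on the sampled string: as [h z] reads no cell of [x j], the string is frozen at
    each value z and averaged with its law. *)
Lemma integral_x (S : set cell) j (h : n.-tuple bool -> Om -> \bar R) :
  ~ S (inl (inl j)) ->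
  (forall z, measurable_fun setT (h z : block_space F S -> _)) ->
  (forall z om, 0 <= h z om)%E ->
  (\int[P]_om h (x j om) om = \sum_z (G psi z)%:E * \int[P]_om h z om)%E.
Proof.
move=> Sj mh h0.
rewrite (integral_finite_split P (x_set1_measurable j))//; last first.
  by move=> z; exact: block_fun_measurable (mh z).
apply: eq_bigr => z _.
rewrite (@integral_mul_tapes [set inl (inl j)] S)//; last 2 first.
- by apply/seteqP; split=> // c [/= -> /Sj].
- apply/measurable_EFinP/measurable_indic.
  exact: x_measurable.
by rewrite integral_indic_probability ?(tape_x_law tapes)//; exact: x_set1_measurable.
Qed.

(** * Hoeffding's inequality for the sampled strings *)

Section hoeffding.
Variables (f : n.-tuple bool -> R) (mu : R).
Hypothesis f01 : forall z, 0 <= f z <= 1.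
Hypothesis muE : \sum_z G psi z * f z = mu.

Lemma mean01 : 0 <= mu <= 1.
Proof.
rewrite -muE; apply/andP; split.
  by apply: sumr_ge0 => z _; rewrite mulr_ge0 ?outdist_ge0//; case/andP: (f01 z).
rewrite -(outdist_sum1 G psi); apply: ler_sum => z _.
by rewrite ler_piMr ?outdist_ge0//; case/andP: (f01 z).
Qed.

Let xs N : set cell := [set c | exists2 j, (j < N)%N & c = inl (inl j)].

Lemma measurable_fx (S : set cell) (g : n.-tuple bool -> R) j : S (inl (inl j)) ->
  measurable_fun setT ((fun om => g (x j om)) : block_space F S -> R).
Proof.
move=> Sj _ B mB; rewrite setTI.
exact: (@x_measurable S j Sj [set z | B (g z)]).
Qed.

(** The chord of exp reduces a variable with values in [0, 1] to a Bernoulli variable of the same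
    mean. *)
Lemma integral_expR_fx (lam : R) j : 0 <= lam ->
  (\int[P]_om (expR (lam * f (x j om)))%:E <= (expR (lam * mu + lam ^+ 2 / 8))%:E)%E.
Proof.
move=> l0.
rewrite (@integral_x set0 j (fun z _ => (expR (lam * f z))%:E))//.
under eq_bigr do rewrite integral_cst_probability -EFinM.
rewrite sumEFin lee_fin; apply: le_trans (hoeffding_bernoulli mean01 l0).
apply: (@le_trans _ _ (\sum_z G psi z * (1 - f z + f z * expR lam))).
  apply: ler_sum => z _; apply: ler_wpM2l; first exact: outdist_ge0.
  exact: expR_le_chord.
rewrite -[1 in leRHS](outdist_sum1 G psi) -muE mulr_suml -sumrB -big_split/=.
by apply: ler_sum => z _; rewrite le_eqVlt; apply/orP; left; apply/eqP; ring.
Qed.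

Lemma integral_expR_sum_fx (lam : R) N : 0 <= lam ->
  (\int[P]_om (expR (lam * \sum_(j < N) f (x j om)))%:E <=
   (expR (N%:R * (lam * mu + lam ^+ 2 / 8)))%:E)%E.
Proof.
move=> l0; elim: N => [|N IH].
  under eq_integral do rewrite big_ord0 mulr0 expR0.
  by rewrite integral_cst_probability mul0r expR0.
under eq_integral do rewrite big_ord_recr/= mulrDr expRD EFinM.
rewrite (@integral_mul_tapes (xs N) [set inl (inl N)]).
- rewrite -natr1 mulrDl mul1r expRD EFinM.
  apply: lee_pmul => //; last exact: integral_expR_fx.
  + by apply: integral_ge0 => om _; rewrite lee_fin expR_ge0.
  + by apply: integral_ge0 => om _; rewrite lee_fin expR_ge0.
- by apply/seteqP; split=> // c [[j jN ->] /= [jE]]; rewrite jE ltnn in jN.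
- apply/measurable_EFinP; apply: measurableT_comp => //.
  apply: measurable_funM => //; apply: measurable_sum => j.
  by apply: measurable_fx; exists j.
- apply/measurable_EFinP; apply: measurableT_comp => //.
  by apply: measurable_funM => //; exact: measurable_fx.
- by move=> om; rewrite lee_fin expR_ge0.
- by move=> om; rewrite lee_fin expR_ge0.
Qed.

Lemma hoeffding_tail N (tau : R) : 0 < tau ->
  (P [set om | (N%:R * (mu + tau) <= \sum_(j < N) f (x j om))%R]
   <= (expR (- (2 * N%:R * tau ^+ 2)))%:E)%E.
Proof.
(* The parameter 4 tau minimises lam^2 / 8 - lam tau, with value -2 tau^2; [c] scales the
   exponential moment to mean at most 1. *)
move=> t0; pose c := expR (- (N%:R * (4 * tau * mu + (4 * tau) ^+ 2 / 8))).
have msum : measurable_fun setT (fun om => \sum_(j < N) f (x j om)).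
  apply: measurable_sum => j.
  by apply: (@block_fun_measurable _ _ setT); exact: measurable_fx.
have mY : measurable_fun setT (fun om => expR (4 * tau * \sum_(j < N) f (x j om))).
  by apply: measurableT_comp => //; exact: measurable_funM.
rewrite expRN; apply: (@expR_chernoff _ _ _ P (fun om => c%:E *
  (expR (4 * tau * \sum_(j < N) f (x j om)))%:E)%E).
- by apply: emeasurable_funM => //; exact/measurable_EFinP.
- by move=> om; rewrite -EFinM lee_fin mulr_ge0 ?expR_ge0.
- by apply: measurable_set_bool; apply: measurable_fun_ler.
- exact: expR_gt0.
- move=> om /= h; rewrite -EFinM lee_fin /c -expRD ler_expR.
  set S := \sum_(j < N) _ in h *; move: S h => S h.
  rewrite -subr_ge0.
  have -> : - (N%:R * (4 * tau * mu + (4 * tau) ^+ 2 / 8)) + 4 * tau * S -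
    2 * N%:R * tau ^+ 2 = 4 * tau * (S - N%:R * (mu + tau)) by field.
  by rewrite mulr_ge0// ?subr_ge0// mulr_ge0// ltW.
- rewrite ge0_integralZl//; last 2 first.
  + exact/measurable_EFinP.
  + by rewrite lee_fin expR_ge0.
  have l0 : 0 <= 4 * tau by rewrite mulr_ge0// ltW.
  apply: (@le_trans _ _ (c%:E * (expR (N%:R * (4 * tau * mu + (4 * tau) ^+ 2 / 8)))%:E)%E).
    by rewrite lee_wpmul2l ?lee_fin ?expR_ge0// integral_expR_sum_fx.
  by rewrite -EFinM /c mulrC expRxMexpNx_1.
Qed.

End hoeffding.

Definition call_bits j (z : n.-tuple bool) (i : 'I_n) t om : bool :=
  tnth (w j i t (SubCond psi (take i z)) om) i == tnth z i.

(** Cells for all inputs are included, so the block of a call does not depend on the string being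
    estimated. *)
Definition call_block j (i : 'I_n) : set cell := [set c | match c with
  | inl (inl _) => False
  | inl (inr (j', i', _, _)) => j' = j /\ i' = i
  | inr (j', i', _) => j' = j /\ i' = i
  end].

Lemma call_bits_measurable (S : set cell) j z i : call_block j i `<=` S ->
  forall t, measurable_fun setT (call_bits j z i t : block_space F S -> bool).
Proof.
move=> cS t _ A _; rewrite setTI.
apply: (block_cell_measurable tape_events_setT
  (cS (inl (inr (j, i, t, SubCond psi (take i z)))) _)) => //=.
by exists [set y | A (tnth y i == tnth z i)].
Qed.

Lemma call_clock_measurable (S : set cell) j i : call_block j i `<=` S ->
  forall t, measurable_fun setT (a j i t : block_space F S -> R).
Proof.
move=> cS t _ A mA; rewrite setTI.
apply: (block_cell_measurable tape_events_setT (cS (inr (j, i, t)) _)) => //=.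
by exists A.
Qed.

Lemma call_bits_law j z i t : P (call_bits j z i t @^-1` [set true]) = (p z i)%:E.
Proof.
rewrite /bit_prob -(@probability_finite_pred _ _ _ P _
  (w j i t (SubCond psi (take i z))) _ _ (fun y => tnth y i == tnth z i)
  (tape_w_law tapes j i t _))//.
move=> y; apply: (F_m (c := inl (inr (j, i, t, SubCond psi (take i z))))).
by exists [set y].
Qed.

(** * Joint exponential moments of the calls made by Est *)

Section calls.
Variable k : nat.
Hypothesis k_gt0 : (0 < k)%N.

Local Notation call_halts j z i := (halts (call_bits j z i) k).
Local Notation call_mart theta j z i :=
  (stopped_gmart (call_bits j z i) (a j i) k (p z i) theta).
Definition call_r j z i : Om -> R := stop_clock (call_bits j z i) (a j i) k.

Let p01 z i : 0 <= p z i <= 1.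
Proof. by rewrite bit_prob_ge0 bit_prob_le1. Qed.

Lemma integral_call_mart theta j z i : theta < 1 ->
  (\int[P]_om call_mart theta j z i om <= 1)%E.
Proof.
move=> th1; apply: (@integral_stopped_gmart _ _ _ P _ F F_m tape_events_setT
  tape_events_setI F_i _ _ (fun t => inl (inr (j, i, t, SubCond psi (take i z))))
  (fun t => inr (j, i, t))) => //.
- by move=> t u [].
- by move=> t u [].
- by move=> t A; exists [set y | A (tnth y i == tnth z i)].
- by move=> t B mB; exists B.
- exact: call_bits_law.
- exact: (tape_a_law tapes).
Qed.

Lemma integral_call_lifetime j z i :
  ((p z i)%:E * \int[P]_om lifetime R (call_bits j z i) k om <= k%:R%:E)%E.
Proof.
apply: (@integral_lifetime _ _ _ P _ F F_m tape_events_setT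
  tape_events_setI F_i _ (fun t => inl (inr (j, i, t, SubCond psi (take i z))))
  (fun t => inr (j, i, t))) => //.
- by move=> t u [].
- by move=> t A; exists [set y | A (tnth y i == tnth z i)].
- exact: call_bits_law.
Qed.

Lemma call_halts_as j z i : 0 < p z i -> P (~` [set om | call_halts j z i om]) = 0%E.
Proof.
apply: (@halts_almost_surely _ _ _ P _ F F_m tape_events_setT
  tape_events_setI F_i _ (fun t => inl (inr (j, i, t, SubCond psi (take i z))))
  (fun t => inr (j, i, t))) => //.
- by move=> t u [].
- by move=> t A; exists [set y | A (tnth y i == tnth z i)].
- exact: call_bits_law.
Qed.

Definition calls_block j (s : seq 'I_n) : set cell :=
  [set c | exists2 i, i \in s & call_block j i c].

Lemma measurable_call_marts (S : set cell) theta j z s : theta < 1 ->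
  (forall i, i \in s -> call_block j i `<=` S) ->
  measurable_fun setT
    ((fun om => \prod_(i <- s) call_mart theta j z i om)%E : block_space F S -> _).
Proof.
move=> th1; elim: s => [|i s IH] sS.
  by under eq_fun do rewrite big_nil; exact: measurable_cst.
under eq_fun do rewrite big_cons.
apply: emeasurable_funM; last by apply: IH => i' i's; apply: sS; rewrite in_cons i's orbT.
have iS : call_block j i `<=` S by apply: sS; rewrite mem_head.
apply: measurable_stopped_gmart => //; first exact: call_bits_measurable.
exact: call_clock_measurable.
Qed.

Lemma call_marts_ge0 theta j z s om : theta < 1 ->
  (0 <= \prod_(i <- s) call_mart theta j z i om)%E.
Proof.
by move=> th1; apply: prode_ge0 => i _; exact: stopped_gmart_ge0.
Qed.

Lemma integral_call_marts theta j z s : theta < 1 -> uniq s ->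
  (\int[P]_om (\prod_(i <- s) call_mart theta j z i om) <= 1)%E.
Proof.
move=> th1; elim: s => [|i s IH] /=.
  by move=> _; under eq_integral do rewrite big_nil; rewrite integral_cst_probability.
move=> /andP[iS us]; under eq_integral do rewrite big_cons.
rewrite (@integral_mul_tapes (call_block j i) (calls_block j s)).
- rewrite -[leRHS]mule1; apply: lee_pmul; last exact: IH.
  + by apply: integral_ge0 => om _; exact: stopped_gmart_ge0.
  + by apply: integral_ge0 => om _; exact: call_marts_ge0.
  + exact: integral_call_mart.
- apply/seteqP; split=> // c [ci [i' i's ci']].
  suff ii' : i = i' by rewrite ii' i's in iS.
  by case: c ci ci' => [[//|[[[j1 i1] t1] phi]]|[[j1 i1] t1]] /= [_ <-] [_ <-].
- apply: measurable_stopped_gmart => //; first exact: call_bits_measurable.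
  exact: call_clock_measurable.
- by apply: measurable_call_marts => // i' i's c ci'; exists i'.
- by move=> om; exact: stopped_gmart_ge0.
- by move=> om; exact: call_marts_ge0.
Qed.

(** Keeping [theta] on both sides serves both tails: theta > 0 for the upper, theta < 0 for the
    lower. Termination is part of [A] because the stopped martingale has its explicit lower bound
    only on halting runs. *)
Lemma chernoff_calls theta j z s c A : theta < 1 -> uniq s -> measurable A ->
  (forall om, A om -> (forall i, i \in s -> call_halts j z i om) /\
     theta * c <= theta * \sum_(i <- s) p z i * call_r j z i om) ->
  (P A <= (expR (- (theta * c)) * ((1 - theta) ^+ (size s * k))^-1)%:E)%E.
Proof.
move=> th1 us mA hA.
have th0 : 0 < 1 - theta by rewrite subr_gt0.
rewrite expRN -invfM; apply: (@expR_chernoff _ _ _ P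
  (fun om => \prod_(i <- s) call_mart theta j z i om)%E) => //.
- apply: (@block_fun_measurable _ _ setT).
  exact: measurable_call_marts.
- by move=> om; exact: call_marts_ge0.
- by rewrite mulr_gt0 ?expR_gt0 ?exprn_gt0.
- move=> om /hA[sh sc].
  apply: (@le_trans _ _ (\prod_(i <- s)
    (expR (theta * p z i * call_r j z i om) * (1 - theta) ^+ k)%:E)%E).
    have -> : (\prod_(i <- s) (expR (theta * p z i * call_r j z i om) * (1 - theta) ^+ k)%:E)%E
        = (\prod_(i <- s) (expR (theta * p z i * call_r j z i om) * (1 - theta) ^+ k))%:E.
      by elim: (s) => [|i s' IH]; rewrite ?big_nil// !big_cons IH EFinM.
    rewrite lee_fin big_split/= -expR_sum big_const_seq count_predT iter_mulr mulr1 -exprM mulnC.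
    rewrite ler_pM2r ?exprn_gt0// ler_expR; apply: (le_trans sc).
    by rewrite mulr_sumr le_eqVlt; apply/orP; left; apply/eqP; apply: eq_bigr => i _; rewrite mulrA.
  have {sc hA us}: all (fun i => `[< call_halts j z i om >]) s.
    by apply/allP => i /sh h; apply/asboolP.
  elim: (s) => [|i s' IH]; first by rewrite !big_nil.
  move=> /= /andP[/asboolP hi hs]; rewrite !big_cons; apply: lee_pmul.
  + by rewrite lee_fin mulr_ge0 ?expR_ge0 ?exprn_ge0// ltW.
  + by apply: prode_ge0 => i' _; rewrite lee_fin mulr_ge0 ?expR_ge0 ?exprn_ge0// ltW.
  + exact: stopped_gmart_halts.
  + exact: IH.
- exact: integral_call_marts.
Qed.

(** * Accuracy of one run of Est *)

Section est_tail.
Variables (t D L : R).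
Hypothesis n_gt0 : (0 < n)%N.
Hypothesis t_bounds : 0 < t <= 2^-1.
Hypothesis D_def : D = t / (1 + t).
Hypothesis L_ge : 7 / 2 <= L.
Hypothesis k_ge : 369 / 100 * L * n%:R <= k%:R * D ^+ 2.

Let e := D / Num.sqrt n%:R.

Definition call_g j z i om : R := p z i * call_r j z i om / (k%:R - 1).

Definition est_good j z : set Om :=
  \bigcap_(i in setT) [set om | call_halts j z i om] `&`
  (\bigcap_(i in setT) [set om | `|call_g j z i om - 1| <= e] `&`
   [set om | `|\sum_i (call_g j z i om - 1)| <= D]).

Let nR : 1 <= n%:R :> R.
Proof. by rewrite ler1n. Qed.

Let D_bounds : 0 < D <= 3^-1.
Proof.
case/andP: t_bounds => t0 t2; rewrite D_def divr_gt0 ?addr_gt0//=.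
by rewrite ler_pdivrMr ?addr_gt0//; lra.
Qed.

Let sqrtn : 1 <= Num.sqrt n%:R :> R.
Proof. by rewrite -[leLHS]sqrtr1 ler_sqrt. Qed.

Let e2n : e ^+ 2 * n%:R = D ^+ 2.
Proof.
rewrite /e expr_div_n sqr_sqrtr ?ler0n// divfK// gt_eqF//.
by apply: lt_le_trans nR.
Qed.

Let e_bounds : 0 <= e <= D.
Proof.
case/andP: D_bounds => D0 _.
have s0 : 0 < Num.sqrt n%:R :> R by apply: lt_le_trans sqrtn.
apply/andP; split; first by rewrite divr_ge0// ltW.
by rewrite ler_pdivrMr// ler_peMr// ltW.
Qed.

Let K_gt0 : 0 < k%:R - 1 :> R.
Proof.
have D2 : D ^+ 2 <= 1 by case/andP: D_bounds => *; nra.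
have L0 : 0 <= 369 / 100 * L by rewrite mulr_ge0//; apply: le_trans L_ge; lra.
have : 369 / 100 * L * 1 <= 369 / 100 * L * n%:R by apply: ler_wpM2l => //; exact: nR.
have : k%:R * D ^+ 2 <= k%:R * 1 :> R by rewrite ler_wpM2l.
by move: L_ge k_ge; lra.
Qed.

Lemma est_good_measurable (S : set cell) j z : (forall i, call_block j i `<=` S) ->
  @measurable _ (block_space F S) (est_good j z).
Proof.
move=> cS.
have mb i := call_bits_measurable z (cS i).
have ma i := call_clock_measurable (cS i).
have mg i : measurable_fun setT (call_g j z i : block_space F S -> R).
  apply: measurable_funM => //; apply: measurable_funM => //.
  exact: measurable_stop_clock.
apply: measurableI; [|apply: measurableI].
- by apply: fin_bigcap_measurable => // i _; exact: measurable_halts.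
- apply: fin_bigcap_measurable => // i _; apply: measurable_set_bool.
  apply: measurable_fun_ler => //; apply: measurableT_comp => //.
  by apply: measurable_funB.
- apply: measurable_set_bool; apply: measurable_fun_ler => //.
  apply: measurableT_comp => //; apply: measurable_sum => i.
  by apply: measurable_funB.
Qed.

Let mhalts j z : measurable (\bigcap_(i in setT) [set om | call_halts j z i om]).
Proof.
apply: fin_bigcap_measurable => // i _; apply: (measurable_halts R) => t'.
by apply: (@block_fun_measurable _ _ setT); exact: call_bits_measurable.
Qed.

Let msum j z s :
  measurable_fun setT (fun om => \sum_(i <- s) p z i * call_r j z i om).
Proof.
apply: measurable_sum => i; apply: measurable_funM => //.
apply: (@block_fun_measurable _ _ setT); apply: measurable_stop_clock => //.
  exact: call_bits_measurable.
exact: call_clock_measurable.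
Qed.

(** [s] will be a single call or the list of all calls. The relation with D^2 makes eps equal to D /
    sqrt n or D / n respectively, and the quantity m k eps^2 = k D^2 / n the same in both cases. *)
Lemma est_upper_tail j z (s : seq 'I_n) (eps : R) : uniq s -> 0 <= eps <= 3^-1 ->
  (size s)%:R * eps <= 3^-1 -> (size s)%:R * eps ^+ 2 * n%:R = D ^+ 2 ->
  (P (\bigcap_(i in setT) [set om | call_halts j z i om] `&`
    [set om | ((size s)%:R * (k%:R - 1) * (1 + eps) <=
      \sum_(i <- s) p z i * call_r j z i om)%R]) <= (expR (- L) / 2)%:E)%E.
Proof.
move=> us eps01 seps sD.
have [e0 e3] := andP eps01.
have h1 : 0 < 1 + eps by lra.
apply: (@le_trans _ _ (expR (- (eps / (1 + eps) * ((size s)%:R * (k%:R - 1) * (1 + eps)))) *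
    ((1 - eps / (1 + eps)) ^+ (size s * k))^-1)%:E); last first.
  rewrite lee_fin; apply: chernoff_upper_value => //.
  rewrite -(ler_pM2r (x := n%:R)) ?(lt_le_trans _ nR)//.
  have -> : (size s)%:R * k%:R * eps ^+ 2 * n%:R = k%:R * D ^+ 2.
    by rewrite -sD; ring.
  exact: k_ge.
apply: (@chernoff_calls _ j z) => //.
- by rewrite ltr_pdivrMr//; lra.
- by apply: measurableI => //; apply: measurable_set_bool; exact: measurable_fun_ler.
- move=> om [h1' h2]; split; first by move=> i _; exact: h1'.
  by rewrite ler_wpM2l// divr_ge0// ltW.
Qed.

Lemma est_lower_tail j z (s : seq 'I_n) (eps : R) : uniq s -> 0 <= eps <= 3^-1 ->
  (size s)%:R * eps ^+ 2 * n%:R = D ^+ 2 ->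
  (P (\bigcap_(i in setT) [set om | call_halts j z i om] `&`
    [set om | (\sum_(i <- s) p z i * call_r j z i om <=
      (size s)%:R * (k%:R - 1) * (1 - eps))%R]) <= (expR (- L) / 2)%:E)%E.
Proof.
move=> us eps01 sD.
have [e0 e3] := andP eps01.
apply: (@le_trans _ _ (expR (- (- (4 / 5 * eps) * ((size s)%:R * (k%:R - 1) * (1 - eps)))) *
    ((1 - (- (4 / 5 * eps))) ^+ (size s * k))^-1)%:E); last first.
  rewrite lee_fin; apply: chernoff_lower_value => //.
  rewrite -(ler_pM2r (x := n%:R)) ?(lt_le_trans _ nR)//.
  have -> : (size s)%:R * k%:R * eps ^+ 2 * n%:R = k%:R * D ^+ 2.
    by rewrite -sD; ring.
  exact: k_ge.
apply: (@chernoff_calls _ j z) => //.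
- by lra.
- by apply: measurableI => //; apply: measurable_set_bool; exact: measurable_fun_ler.
- move=> om [h1' h2]; split; first by move=> i _; exact: h1'.
  by rewrite ler_wnM2l//; lra.
Qed.

(** Each of the n calls, and their sum, has a two-sided tail of mass exp (-L); the n + 1 terms are
    at most 2 n. Non-termination adds nothing, since every bit probability of [z] is positive. *)
Lemma est_bad_prob j z : 0 < G psi z ->
  (P (~` est_good j z) <= (2 * n%:R * expR (- L))%:E)%E.
Proof.
move=> Gz; have K0 := K_gt0.
have Kg i om : p z i * call_r j z i om = call_g j z i om * (k%:R - 1).
  by rewrite /call_g divfK// gt_eqF.
pose H := \bigcap_(i in setT) [set om | call_halts j z i om].
pose U (s : seq 'I_n) (eps : R) := H `&` [set om | (size s)%:R * (k%:R - 1) * (1 + eps) <=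
      \sum_(i <- s) p z i * call_r j z i om].
pose V (s : seq 'I_n) (eps : R) := H `&` [set om | \sum_(i <- s) p z i * call_r j z i om <=
      (size s)%:R * (k%:R - 1) * (1 - eps)].
have mU s eps : measurable (U s eps).
  apply: measurableI; first exact: mhalts.
  by apply: measurable_set_bool; apply: measurable_fun_ler => //; exact: msum.
have mV s eps : measurable (V s eps).
  apply: measurableI; first exact: mhalts.
  by apply: measurable_set_bool; apply: measurable_fun_ler => //; exact: msum.
pose N (i : 'I_n) := ~` [set om | call_halts j z i om].
have mN i : measurable (N i).
  apply/measurableC/(measurable_halts R) => t'.
  by apply: (@block_fun_measurable _ _ setT); exact: call_bits_measurable.
have mNUV i : measurable (N i `|` (U [:: i] e `|` V [:: i] e)).
  by apply: measurableU => //; exact: measurableU.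
pose s0 := enum 'I_n; pose e0 := D / n%:R.
have n0 : 0 < n%:R :> R by apply: lt_le_trans nR.
have ne0 : n%:R * e0 = D by rewrite /e0 mulrC divfK// gt_eqF.
have sub : ~` est_good j z `<=`
    \big[setU/set0]_(i <- s0) (N i `|` (U [:: i] e `|` V [:: i] e)) `|`
    (U s0 e0 `|` V s0 e0).
  move=> om; apply: contra_notP => /not_orP[hi /not_orP[h2 h3]].
  have {}hi i : ~ (N i `|` (U [:: i] e `|` V [:: i] e)) om.
    by move=> h; apply: hi; rewrite -bigcup_seq; exists i => //=; rewrite mem_enum.
  have hH : H om by move=> i _ /=; apply/not_notP => nh; apply: (hi i); left.
  split=> //; split=> [i _ /=|/=].
    have hU : ~ U [:: i] e om by move=> h; apply: (hi i); right; left.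
    have hV : ~ V [:: i] e om by move=> h; apply: (hi i); right; right.
    have : ~~ (1%:R * (k%:R - 1) * (1 + e) <= \sum_(i' <- [:: i]) p z i' * call_r j z i' om).
      by apply/negP => h; apply: hU.
    have : ~~ (\sum_(i' <- [:: i]) p z i' * call_r j z i' om <= 1%:R * (k%:R - 1) * (1 - e)).
      by apply/negP => h; apply: hV.
    rewrite !big_seq1 Kg -!ltNge mul1r ![(k%:R - 1) * _]mulrC !ltr_pM2r//.
    by move=> *; rewrite ler_norml; apply/andP; split; lra.
  have : ~~ (n%:R * (k%:R - 1) * (1 + e0) <= \sum_(i <- s0) p z i * call_r j z i om).
    by apply/negP => h; apply: h2; split => //=; rewrite size_enum_ord.
  have : ~~ (\sum_(i <- s0) p z i * call_r j z i om <= n%:R * (k%:R - 1) * (1 - e0)).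
    by apply/negP => h; apply: h3; split => //=; rewrite size_enum_ord.
  rewrite sumrB sumr_const card_ord.
  rewrite (eq_bigr (fun i => call_g j z i om * (k%:R - 1))); last by move=> i _; exact: Kg.
  rewrite -mulr_suml big_enum/= -!ltNge.
  have -> : n%:R * (k%:R - 1) * (1 - e0) = (n%:R - D) * (k%:R - 1).
    by rewrite -ne0; ring.
  have -> : n%:R * (k%:R - 1) * (1 + e0) = (n%:R + D) * (k%:R - 1).
    by rewrite -ne0; ring.
  rewrite !ltr_pM2r//.
  by move=> *; rewrite ler_norml; apply/andP; split; lra.
have [D0 D3] := andP D_bounds; have [ee0 eD] := andP e_bounds.
have e03 : 0 <= e0 <= 3^-1.
  apply/andP; split; first by rewrite divr_ge0// ltW.
  apply: le_trans D3; rewrite ler_pdivrMr// ler_peMr ?nR//; exact: ltW.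
have e3 : 0 <= e <= 3^-1 by rewrite ee0/=; exact: le_trans D3.
have UE i : (P (U [:: i] e) <= (expR (- L) / 2)%:E)%E.
  by apply: est_upper_tail; rewrite ?mul1r//; case/andP: e3.
have VE i : (P (V [:: i] e) <= (expR (- L) / 2)%:E)%E.
  by apply: est_lower_tail; rewrite ?mul1r.
have n2 : n%:R * e0 ^+ 2 * n%:R = D ^+ 2 by rewrite -ne0; ring.
have U0E : (P (U s0 e0) <= (expR (- L) / 2)%:E)%E.
  apply: est_upper_tail => //; rewrite ?enum_uniq ?size_enum_ord//.
  by rewrite ne0.
have V0E : (P (V s0 e0) <= (expR (- L) / 2)%:E)%E.
  by apply: est_lower_tail => //; rewrite ?enum_uniq ?size_enum_ord.
have NE i : P (N i) = 0%E by apply: call_halts_as; exact: bit_prob_gt0.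
have half : ((expR (- L) / 2)%:E + (expR (- L) / 2)%:E = (expR (- L))%:E)%E.
  by rewrite -EFinD; congr EFin; field.
have NUV i : (P (N i `|` (U [:: i] e `|` V [:: i] e)) <= (expR (- L))%:E)%E.
  apply: (le_trans (probabilityU_le _ _ _)) => //; first exact: measurableU.
  rewrite -[leRHS]add0e; apply: leeD; first by rewrite NE.
  by apply: (le_trans (probabilityU_le _ _ _)) => //; rewrite -half; exact: leeD.
apply: (@le_trans _ _ (P (\big[setU/set0]_(i <- s0) (N i `|` (U [:: i] e `|` V [:: i] e)) `|`
    (U s0 e0 `|` V s0 e0)))).
  apply: le_measure => //; rewrite inE.
    apply: measurableC; apply: (block_space_measurable F_m (S := setT)).
    exact: est_good_measurable.
  by apply: measurableU; [exact: bigsetU_measurable|exact: measurableU].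
apply: (le_trans (probabilityU_le _ _ _)) => //.
- exact: bigsetU_measurable.
- exact: measurableU.
apply: (@le_trans _ _ ((n%:R * expR (- L))%:E + (expR (- L))%:E)%E).
  apply: leeD; last by apply: (le_trans (probabilityU_le _ _ _)) => //; rewrite -half; exact: leeD.
  apply: (le_trans (probability_bigU_le _ _ _)) => //.
  rewrite big_enum/=.
  apply: (@le_trans _ _ (\sum_(i < n) (expR (- L))%:E)%E); first by apply: lee_sum => i _.
  by rewrite sumEFin lee_fin sumr_const card_ord mulr_natl.
rewrite -EFinD lee_fin; have := expR_gt0 (- L); have := nR; nra.
Qed.

Lemma est_good_error j z om (W : R) : 0 < G psi z -> 0 <= W -> est_good j z om ->
  `|Num.max 0 (1 - W / \prod_i ((k%:R - 1) / call_r j z i om)) -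
    Num.max 0 (1 - W / G psi z)| <= t.
Proof.
move=> Gz W0 [_ [gi gD]].
have [D0 D3] := andP D_bounds; have [ee0 eD] := andP e_bounds.
have e3 : e <= 3^-1 by exact: le_trans D3.
have {}gi i : `|call_g j z i om - 1| <= e by exact: gi.
(* Closeness to 1 keeps g_i positive, so the clock is nonzero and the division in GBAS is
   genuine. *)
have g0 i : 0 < call_g j z i om.
  have := gi i; rewrite ler_norml => /andP[g1 _]; move: g1 e3; lra.
have r0 i : call_r j z i om != 0.
  apply/eqP => rE; have := g0 i; by rewrite /call_g rE mulr0 mul0r ltxx.
have K0 : k%:R - 1 != 0 :> R by rewrite gt_eqF.
have V0 : \prod_i ((k%:R - 1) / call_r j z i om) != 0.
  by apply/prodf_neq0 => i _; rewrite mulf_neq0// invr_neq0.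
have GV : G psi z / \prod_i ((k%:R - 1) / call_r j z i om) = \prod_i call_g j z i om.
  rewrite -(prod_bit_prob G_cond Gz) -prodf_div; apply: eq_bigr => i _.
  by rewrite /call_g; field; rewrite K0 r0.
apply: le_trans (dist_max0_le W0 Gz V0 _) _; rewrite GV.
  by apply: prodr_ge0 => i _; exact: ltW.
by apply: (prod_near_one t_bounds D_def _ e3 gi gD); rewrite e2n.
Qed.

(** The string is independent of the tapes of its own estimation, so the bound for fixed z is
    averaged. Strings of probability 0, which that bound does not cover, have weight 0. *)
Lemma est_bad_x_prob j :
  (P [set om | ~ est_good j (x j om) om] <= (2 * n%:R * expR (- L))%:E)%E.
Proof.
pose S : set cell := [set c | exists i, call_block j i c].
have cS i : call_block j i `<=` S by move=> c ci; exists i.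
have mB z : @measurable _ (block_space F S) (~` est_good j z).
  by apply: measurableC; exact: est_good_measurable.
have mB' z : measurable (~` est_good j z) by exact: (block_space_measurable F_m (mB z)).
have mind z : measurable_fun setT
    ((fun om => (\1_(~` est_good j z) om)%:E) : block_space F S -> \bar R).
  exact/measurable_EFinP/measurable_indic.
have mA : measurable [set om | ~ est_good j (x j om) om].
  rewrite (_ : mkset _ = \bigcup_(z in setT) (x j @^-1` [set z] `&` ~` est_good j z)).
    apply: fin_bigcup_measurable => // z _; apply: measurableI => //.
    exact: x_set1_measurable.
  apply/seteqP; split=> om /=; first by move=> h; exists (x j om).
  by move=> [z _ [/= -> h]].
rewrite -integral_indic_probability//.
rewrite (eq_integral (fun om => (\1_(~` est_good j (x j om)) om)%:E)); last first.
  move=> om _; rewrite !indicE; congr ((nat_of_bool _)%:R)%:E.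
rewrite (@integral_x S j (fun z om => (\1_(~` est_good j z) om)%:E))//; last first.
  by move=> [i].
have -> : ((2 * n%:R * expR (- L))%:E =
    (\sum_z (G psi z)%:E) * (2 * n%:R * expR (- L))%:E)%E.
  by rewrite sumEFin outdist_sum1 mul1e.
rewrite ge0_sume_distrl; last first.
  by move=> z _; rewrite lee_fin outdist_ge0.
apply: lee_sum => z _; rewrite integral_indic_probability//.
have [Gz|Gz] := ltP 0 (G psi z).
  apply: lee_wpmul2l; first by rewrite lee_fin outdist_ge0.
  exact: est_bad_prob.
have -> : G psi z = 0 by apply/le_anti; rewrite Gz outdist_ge0.
by rewrite !mul0e.
Qed.

End est_tail.

Lemma measurable_call_lifetime (S : set cell) j z i : call_block j i `<=` S ->
  measurable_fun setT (lifetime R (call_bits j z i) k : block_space F S -> _).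
Proof. by move=> cS; apply: measurable_lifetime; exact: call_bits_measurable. Qed.

(** For a fixed string the mean length is at most k / p_i, with no uniform bound; averaging over
    strings repairs this through [sum_div_bit_prob]. A string of probability 0 may have infinite
    mean length, absorbed by the convention that 0 times +oo is 0. *)
Lemma integral_lifetime_x j i :
  (\int[P]_om lifetime R (call_bits j (x j om) i) k om <= (2 * k%:R)%:E)%E.
Proof.
have l0 z om : (0 <= lifetime R (call_bits j z i) k om)%E.
  by apply: nneseries_ge0 => t _ _; rewrite lee_fin.
rewrite (@integral_x (call_block j i) j (fun z => lifetime R (call_bits j z i) k))//; last first.
  by move=> z; exact: measurable_call_lifetime.
apply: (@le_trans _ _ (\sum_(z | (0 < G psi z)%R) (G psi z / p z i * k%:R)%:E)%E).
  rewrite [leRHS]big_mkcond/=; apply: lee_sum => z _; case: ifPn => [Gz|].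
    have p0 := bit_prob_gt0 G_cond Gz i.
    rewrite -mulrA EFinM lee_wpmul2l ?lee_fin ?outdist_ge0// mulrC.
    rewrite EFinM lee_pdivlMr// muleC.
    exact: integral_call_lifetime.
  rewrite -leNgt => Gz; have -> : G psi z = 0 by apply/le_anti; rewrite Gz outdist_ge0.
  by rewrite mul0e.
rewrite sumEFin lee_fin -mulr_suml ler_wpM2r//.
exact: sum_div_bit_prob.
Qed.
End calls.
End tapes_law.

(** * Rounding and the arithmetic of the sample complexity *)

Section nat_ceil.
Variable R : realType.

Lemma nat_ceilE (y : R) : 0 <= y -> (nat_ceil y)%:R = (Num.ceil y)%:~R :> R.
Proof.
move=> y0; have c0 : 0 <= Num.ceil y by rewrite ceil_ge0; apply: lt_le_trans y0; lra.
by rewrite /nat_ceil pmulrn gez0_abs.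
Qed.

Lemma nat_ceil_ge (y : R) : 0 <= y -> y <= (nat_ceil y)%:R.
Proof. by move=> y0; rewrite nat_ceilE// ceil_ge. Qed.

Lemma nat_ceil_le (y : R) : 0 <= y -> (nat_ceil y)%:R <= y + 1.
Proof.
move=> y0; rewrite nat_ceilE//; have /andP[+ _] := ceil_itv y.
by rewrite intrB => /ltW; rewrite lerBlDr.
Qed.

End nat_ceil.

(** alpha is O(1 / zeta^2) and k is O(n / zeta^2) up to its logarithm, with n calls per probe. That
    logarithm contains alpha, which n alpha <= A (n / zeta)^2 absorbs, so only ln (n / zeta)
    remains. *)
Lemma sample_complexity (R : realType) (delta : R) : 0 < delta -> delta < 1 / 3 ->
  exists C : R, forall (n : nat) (zeta : R), (0 < n)%N -> 0 < zeta < 1 ->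
  let alpha := cpe_alpha zeta delta in
  let gamma := zeta / (111 / 100 * (2 + zeta)) in
  let delta' := delta / (2 * alpha%:R) in
  let k := nat_ceil (3 * n%:R / gamma ^+ 2 * ln (2 * n%:R / delta')) in
  alpha%:R * (2 * n%:R * k%:R + 1) <=
    C * (n%:R ^+ 2 / zeta ^+ 4) * (1 + ln (n%:R / zeta)).
Proof.
move=> d0 d3.
have l0 : 0 < ln (4 / delta) by rewrite ln_gt0// ltr_pdivlMr//; lra.
pose A := 2 * ln (4 / delta) + 1; have A1 : 1 < A by rewrite /A; lra.
have lA : 0 < ln (4 * A / delta) by rewrite ln_gt0// ltr_pdivlMr//; lra.
pose B := ln (4 * A / delta) + 2; have B0 : 0 < B by rewrite /B; lra.
(* [A] bounds alpha zeta^2 and [B] the logarithm relative to 1 + ln (n / zeta); 36 dominates 3 (1.11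
   * 3)^2, each + 1 covers a rounding, and 3 comes from 2 n k + 1 <= 3 n k'. *)
exists (3 * A * (36 * B + 1)) => n zeta n_gt0 /andP[z0 z1]; cbv zeta.
set alpha := cpe_alpha zeta delta; set gamma := zeta / (_ * _).
set delta' := delta / (2 * _); set k := nat_ceil _.
have n1 : 1 <= n%:R :> R by rewrite ler1n.
have n0 : 0 < n%:R :> R by lra.
have zn0 : zeta != 0 by rewrite gt_eqF.
have z2 : 1 <= (zeta ^+ 2)^-1.
  by rewrite invf_ge1 ?exprn_gt0// expr_le1// ltW.
have z20 : 0 < (zeta ^+ 2)^-1 by lra.
have arg0 : 0 < 2 / zeta ^+ 2 * ln (4 / delta) by rewrite !mulr_gt0.
have alpha0 : 0 < alpha%:R :> R by apply: (lt_le_trans arg0); exact: nat_ceil_ge (ltW arg0).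
have alphaA : alpha%:R <= A * (zeta ^+ 2)^-1.
  apply: (le_trans (nat_ceil_le (ltW arg0))); rewrite /A; nra.
set l := ln (n%:R / zeta).
have nz1 : 1 < n%:R / zeta by rewrite ltr_pdivlMr//; nra.
have l_gt0 : 0 < l by rewrite ln_gt0.
have argE : 2 * n%:R / delta' = 4 * n%:R * alpha%:R / delta.
  by rewrite /delta'; field; rewrite !gt_eqF.
have argL : 4 * n%:R * alpha%:R / delta <= 4 * A / delta * (n%:R / zeta) ^+ 2.
  have -> : 4 * A / delta * (n%:R / zeta) ^+ 2 =
    4 * (n%:R * (n%:R * (A * (zeta ^+ 2)^-1))) / delta.
    by field; rewrite zn0 gt_eqF.
  rewrite ler_pM2r ?invr_gt0// -mulrA ler_pM2l// ler_pM2l//.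
  apply: (le_trans alphaA); rewrite ler_peMl//.
  by rewrite mulr_ge0//; [lra|exact: ltW].
have LB : ln (2 * n%:R / delta') <= B * (1 + l).
  rewrite argE; apply: (@le_trans _ _ (ln (4 * A / delta * (n%:R / zeta) ^+ 2))).
    have p1 : 0 < 4 * n%:R * alpha%:R / delta by rewrite divr_gt0// !mulr_gt0.
    by rewrite ler_ln// posrE//; exact: lt_le_trans argL.
  rewrite lnM ?posrE ?exprn_gt0 ?divr_gt0//; last by rewrite mulr_gt0//; lra.
  rewrite lnXn ?divr_gt0// -/l /B.
  have : 0 <= ln (4 * A / delta) * l by rewrite mulr_ge0// ltW.
  lra.
have L0 : 0 <= ln (2 * n%:R / delta').
  rewrite argE ln_ge0// ler_pdivlMr//.
  have a1 : 1 <= alpha%:R :> R by rewrite ler1n -(ltr0n R).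
  nra.
have g2 : 3 * n%:R / gamma ^+ 2 <= 36 * (n%:R * (zeta ^+ 2)^-1).
  have -> : 3 * n%:R / gamma ^+ 2 = n%:R * (zeta ^+ 2)^-1 * (3 * (111 / 100 * (2 + zeta)) ^+ 2).
    by rewrite /gamma; field; rewrite zn0/=; lra.
  rewrite mulrC ler_pM2r ?mulr_gt0//; nra.
have kle : k%:R <= (36 * B + 1) * (n%:R * (zeta ^+ 2)^-1) * (1 + l).
  have g0 : 0 <= 3 * n%:R / gamma ^+ 2 by rewrite divr_ge0 ?sqr_ge0// mulr_ge0.
  apply: (le_trans (nat_ceil_le (mulr_ge0 g0 L0))).
  have h1 : 3 * n%:R / gamma ^+ 2 * ln (2 * n%:R / delta') <=
    36 * (n%:R * (zeta ^+ 2)^-1) * (B * (1 + l)) by apply: ler_pM.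
  have h2 : 1 <= n%:R * (zeta ^+ 2)^-1 by nra.
  have h3 : 1 <= n%:R * (zeta ^+ 2)^-1 * (1 + l) by nra.
  lra.
set k' := (36 * B + 1) * _ * _ in kle.
have k'1 : 1 <= k'.
  have h2 : 1 <= n%:R * (zeta ^+ 2)^-1 by nra.
  have h3 : 1 <= n%:R * (zeta ^+ 2)^-1 * (1 + l) by nra.
  by rewrite /k' -mulrA; nra.
apply: (@le_trans _ _ (A * (zeta ^+ 2)^-1 * (3 * n%:R * k'))).
  apply: ler_pM; [exact: ltW|by rewrite addr_ge0// !mulr_ge0|by []|].
  have h : n%:R * k%:R <= n%:R * k' by rewrite ler_pM2l.
  have h' : 1 <= n%:R * k' by nra.
  lra.
rewrite /k' le_eqVlt; apply/orP; left; apply/eqP.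
by field.
Qed.

(** * Correctness and sample complexity *)

Section cube_probe.
Context (d : measure_display) (Om : measurableType d) (R : realType).
Variables (P : probability Om R) (m n : nat).
Variables (x : nat -> Om -> n.-tuple bool).
Variables (w : nat -> 'I_n -> nat -> m.-tuple bool -> Om -> n.-tuple bool).
Variables (a : nat -> 'I_n -> nat -> Om -> R).
Variables (IG IW : sampler R m n).
Variables (SubCond : m.-tuple bool -> seq bool -> m.-tuple bool).
Variables (psi : m.-tuple bool) (zeta delta : R).
Hypothesis n_gt0 : (0 < n)%N.
Hypothesis G_cond : is_subcond IG SubCond.
Hypothesis zeta01 : 0 < zeta < 1.
Hypothesis delta_gt0 : 0 < delta.
Hypothesis delta_lt : delta < 1 / 3.
Hypothesis tapes : random_tapes P x w a IG psi.

Local Notation F := (tape_events x w a).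
Local Notation bits := (call_bits w SubCond psi).

Let alpha : nat := cpe_alpha zeta delta.
Let gamma : R := zeta / (111 / 100 * (2 + zeta)).
Let delta' : R := delta / (2 * alpha%:R).
Let L : R := ln (2 * n%:R / delta').
Let k : nat := nat_ceil (3 * n%:R / gamma ^+ 2 * ln (2 * n%:R / delta')).
Let t : R := zeta / 2.
Let D : R := t / (1 + t).

Let est_run j z om : outcome R :=
  est SubCond (fun i t phi => w j i t phi om) (fun i t => a j i t om) psi z gamma delta'.

Let run om : outcome R :=
  cube_probe_est SubCond (IW psi) (fun j => x j om)
    (fun j i t phi => w j i t phi om) (fun j i t => a j i t om) psi zeta delta.

Lemma gbas_callE j (z : n.-tuple bool) i om :
  gbas (fun t => w j i t (SubCond psi (take i z)) om) (fun t => a j i t om) i k (tnth z i) =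
  if pselect (halts (bits j z i) k om) then
    Some ((k%:R - 1) / call_r w a SubCond psi k j z i om, stop_time (bits j z i) k om)
  else None.
Proof.
exact: (gbasE (fun t om => w j i t (SubCond psi (take i z)) om) (fun t om => a j i t om)).
Qed.

Lemma nsamples_omap T T' (f : T -> T') (c : outcome T) :
  nsamples R (omap (fun c : T * nat => (f c.1, c.2)) c) = nsamples R c.
Proof. by case: c => [[v N]|]. Qed.

Lemma nsamples_est j z om :
  nsamples R (est_run j z om) = (\sum_(i < n) lifetime R (bits j z i) k om)%E.
Proof.
rewrite /est_run /est (nsamples_omap (fun s => \prod_(v <- s) v)).
rewrite nsamples_run_seq big_map big_enum/=.
apply: eq_bigr => i _; rewrite gbas_callE; case: pselect => h /=.
  by rewrite lifetime_halts.
by rewrite lifetime_loops.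
Qed.

Lemma est_halts j z om : (forall i, halts (bits j z i) k om) ->
  exists N, est_run j z om =
    Some (\prod_i ((k%:R - 1) / call_r w a SubCond psi k j z i om), N).
Proof.
move=> h; rewrite /est_run /est.
rewrite (run_seq_Some
  (v := fun i => (k%:R - 1) / call_r w a SubCond psi k j z i om)
  (N := fun i => stop_time (bits j z i) k om)); last first.
  by move=> i _; rewrite gbas_callE; case: pselect => // nh; case: nh; exact: h.
by eexists; rewrite /= big_map big_enum.
Qed.

Lemma est_None j z om i : ~ halts (bits j z i) k om -> est_run j z om = None.
Proof.
move=> nh; rewrite /est_run /est; case E: (run_seq _) => [r|]//.
have := run_seq_inv E (mem_enum _ i).
by rewrite gbas_callE; case: pselect => // h; case: nh.
Qed.

Definition cpe_halts : set Om :=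
  [set om | forall j : 'I_alpha, forall i, halts (bits j (x j om) i) k om].

(** A total function that agrees with the output on halting runs, so that measurability can be
    stated for a real-valued map. *)
Definition cpe_value om : R :=
  (\sum_(j < alpha) Num.max 0 (1 - IW psi (x j om) /
     \prod_i ((k%:R - 1) / call_r w a SubCond psi k j (x j om) i om))) / alpha%:R.

Let probe om (j : nat) : outcome R :=
  omap (fun c : R * nat => (Num.max 0 (1 - IW psi (x j om) / c.1), c.2.+1))
    (est_run j (x j om) om).

Lemma runE om : run om = omap (fun c : seq R * nat =>
  ((\sum_(v <- c.1) v) / alpha%:R, c.2)) (run_seq [seq probe om j | j <- iota 0 alpha]).
Proof. by []. Qed.

Lemma run_halts om : cpe_halts om -> exists N, run om = Some (cpe_value om, N).
Proof.
move=> h; rewrite runE.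
have [N NE] : exists N : nat -> nat, forall j, j \in iota 0 alpha ->
    probe om j = Some (Num.max 0 (1 - IW psi (x j om) /
     \prod_i ((k%:R - 1) / call_r w a SubCond psi k j (x j om) i om)), N j).
  have H j : exists N, j \in iota 0 alpha -> probe om j = Some (Num.max 0 (1 - IW psi (x j om) /
     \prod_i ((k%:R - 1) / call_r w a SubCond psi k j (x j om) i om)), N).
    have [ja|ja] := boolP (j \in iota 0 alpha); last by exists 0%N.
    have ja' : (j < alpha)%N by move: ja; rewrite mem_iota add0n.
    have [N NE] := est_halts (fun i => h (Ordinal ja') i).
    by exists N.+1 => _; rewrite /probe NE.
  by have [N NE] := choice H; exists N.
rewrite (run_seq_Some NE); eexists; rewrite /= big_map; congr (Some (_ / _, _)).
by rewrite -{1}[alpha]subn0 big_mkord.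
Qed.

Lemma run_None om : ~ cpe_halts om -> run om = None.
Proof.
move=> /existsNP[j /existsNP[i nh]]; rewrite runE.
case E: (run_seq _) => [r|]//.
have /(run_seq_inv E) : val j \in iota 0 alpha by rewrite mem_iota add0n/=.
by rewrite /probe (est_None nh).
Qed.

Lemma nsamples_runE om : nsamples R (run om) =
  (\sum_(j < alpha) (\sum_(i < n) lifetime R (bits j (x j om) i) k om + 1))%E.
Proof.
rewrite runE (nsamples_omap (fun s => (\sum_(v <- s) v) / alpha%:R)).
rewrite nsamples_run_seq big_map -{1}[alpha]subn0 big_mkord.
apply: eq_bigr => j _; rewrite -nsamples_est /probe.
by case: (est_run _ _ _) => [[v N]|]//=; rewrite -natr1 EFinD.
Qed.

Let z0 : 0 < zeta. Proof. by case/andP: zeta01. Qed.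
Let z1 : zeta < 1. Proof. by case/andP: zeta01. Qed.

(** 4 / delta exceeds 12, while exp 2 <= 9. *)
Let ln4d : 2 <= ln (4 / delta).
Proof.
have e18 := expR_eighth_le R.
have e1 : expR 1 <= 3 :> R.
  have -> : expR 1 = expR (1 / 8) ^+ 8 :> R by rewrite -expRM_natl; congr expR; field.
  apply: (@le_trans _ _ ((8 / 7) ^+ 8)); last by lra.
  by apply: lerXn2r; rewrite ?nnegrE ?expR_ge0.
rewrite -[leLHS]expRK ler_ln ?posrE ?expR_gt0 ?divr_gt0//.
have -> : expR 2 = expR 1 ^+ 2 :> R by rewrite -expRM_natl mulr1.
apply: (@le_trans _ _ (3 ^+ 2)); first by apply: lerXn2r; rewrite ?nnegrE ?expR_ge0.
by rewrite ler_pdivlMr//; move: delta_lt; lra.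
Qed.

Let alpha_arg_ge0 : 0 <= 2 / zeta ^+ 2 * ln (4 / delta).
Proof.
apply: mulr_ge0; first by rewrite divr_ge0// sqr_ge0.
by apply: le_trans ln4d.
Qed.

Let alpha_ge : 2 / zeta ^+ 2 * ln (4 / delta) <= alpha%:R.
Proof. exact: nat_ceil_ge. Qed.

Let alpha4 : 4 <= alpha%:R :> R.
Proof.
apply: le_trans alpha_ge.
have h : 2 <= 2 / zeta ^+ 2.
  rewrite ler_pdivlMr ?exprn_gt0//; have : zeta ^+ 2 <= 1 by rewrite expr_le1// ltW.
  lra.
by apply: (@le_trans _ _ (2 * 2)); [lra|apply: ler_pM].
Qed.

Let alpha0 : 0 < alpha%:R :> R. Proof. by apply: lt_le_trans alpha4. Qed.
Let nR : 1 <= n%:R :> R. Proof. by rewrite ler1n. Qed.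
Let n0 : 0 < n%:R :> R. Proof. by apply: lt_le_trans nR. Qed.
Let delta'0 : 0 < delta'. Proof. by rewrite divr_gt0// mulr_gt0. Qed.

Let LargE : 2 * n%:R / delta' = 4 * n%:R * alpha%:R / delta.
Proof. by rewrite /delta'; field; rewrite !gt_eqF. Qed.

(** From alpha >= 4 and delta < 1/3, the argument 4 n alpha / delta of the logarithm is at least 48,
    which exceeds exp (7/2). *)
Let L_ge : 7 / 2 <= L.
Proof.
have e18 := expR_eighth_le R.
rewrite /L -[leLHS]expRK ler_ln ?posrE ?expR_gt0 ?divr_gt0// ?mulr_gt0//.
apply: (@le_trans _ _ 48).
  have -> : expR (7 / 2) = expR (1 / 8) ^+ 28 :> R by rewrite -expRM_natl; congr expR; field.
  have h4 : expR (1 / 8) ^+ 4 <= (8 / 7) ^+ 4 :> R.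
    by apply: lerXn2r; rewrite ?nnegrE ?expR_ge0.
  have h4' : expR (1 / 8) ^+ 4 <= 171 / 100 :> R by apply: (le_trans h4); lra.
  have -> : expR (1 / 8) ^+ 28 = (expR (1 / 8) ^+ 4) ^+ 7 :> R by rewrite -exprM.
  apply: (@le_trans _ _ ((171 / 100) ^+ 7)); last by lra.
  by apply: lerXn2r; rewrite ?nnegrE ?exprn_ge0 ?expR_ge0.
rewrite LargE ler_pdivlMr//.
have : 4 * 1 * 4 <= 4 * n%:R * alpha%:R :> R.
  by move: nR alpha4; nra.
by move: delta_lt; lra.
Qed.

Let gammaE : gamma = D / (111 / 100).
Proof. by rewrite /gamma /D /t; field; move: z0; lra. Qed.

Let D0 : 0 < D.
Proof. by rewrite /D /t divr_gt0//; move: z0; lra. Qed.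

Let k_arg_ge0 : 0 <= 3 * n%:R / gamma ^+ 2 * ln (2 * n%:R / delta').
Proof.
apply: mulr_ge0; last by apply: le_trans L_ge; lra.
by rewrite divr_ge0 ?sqr_ge0// mulr_ge0.
Qed.

Let k_ge : 369 / 100 * L * n%:R <= k%:R * D ^+ 2.
Proof.
rewrite -ler_pdivrMr ?exprn_gt0//; apply: le_trans (nat_ceil_ge k_arg_ge0).
rewrite -/L gammaE.
have -> : 3 * n%:R / (D / (111 / 100)) ^+ 2 * L = 3 * (111 / 100) ^+ 2 * L * n%:R / D ^+ 2.
  by field; rewrite gt_eqF.
rewrite ler_pM2r ?invr_gt0 ?exprn_gt0// ler_pM2r// ler_pM2r; first by lra.
by move: L_ge; lra.
Qed.

Let k_gt0 : (0 < k)%N.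
Proof.
rewrite lt0n; apply/eqP => kE; have := k_ge; rewrite kE mul0r.
have : 0 < 369 / 100 * L * n%:R by rewrite !mulr_gt0//; move: L_ge; lra.
lra.
Qed.

Let t_bounds : 0 < t <= 2^-1.
Proof. by rewrite /t; move: z0 z1; lra. Qed.

Lemma integral_nsamples_run :
  (\int[P]_om nsamples R (run om) <= (alpha%:R * (2 * n%:R * k%:R + 1))%:E)%E.
Proof.
have l0 z om j i : (0 <= lifetime R (bits j z i) k om)%E.
  by apply: nneseries_ge0 => t' _ _; rewrite lee_fin.
have ml j i : measurable_fun setT (fun om => lifetime R (bits j (x j om) i) k om).
  apply: (measurable_finite_comp (x_set1_measurable tapes j)
    (h := fun z => lifetime R (bits j z i) k)) => z.
  apply: (block_fun_measurable tapes (S := setT)).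
  exact: measurable_call_lifetime.
have mls (j : nat) : measurable_fun setT
    (fun om => \sum_(i < n) lifetime R (bits j (x j om) i) k om)%E.
  by apply: emeasurable_sum => i; exact: ml.
have ls0 (j : nat) om : (0 <= \sum_(i < n) lifetime R (bits j (x j om) i) k om)%E.
  by apply: sume_ge0 => i _; exact: l0.
under eq_integral do rewrite nsamples_runE.
rewrite ge0_integral_sum//; last 2 first.
- by move=> j; apply: emeasurable_funD => //; exact: mls.
- by move=> j om _; rewrite adde_ge0.
apply: (@le_trans _ _ (\sum_(j < alpha) (2 * n%:R * k%:R + 1)%:E)%E); last first.
  by rewrite sumEFin lee_fin sumr_const card_ord -[leLHS]mulr_natl.
apply: lee_sum => j _; rewrite (ge0_integralD P measurableT (fun om _ => ls0 j om) (mls j))//.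
rewrite integral_cst_probability EFinD leeD2r// ge0_integral_sum//.
apply: (@le_trans _ _ (\sum_(i < n) (2 * k%:R)%:E)%E).
  by apply: lee_sum => i _; exact: (integral_lifetime_x G_cond tapes).
by rewrite sumEFin lee_fin sumr_const card_ord -mulr_natl; lra.
Qed.

Let f z : R := Num.max 0 (1 - IW psi z / IG psi z).

Let f01 z : 0 <= f z <= 1.
Proof.
rewrite /f le_max lexx/= ge_max ler01/= gerBl divr_ge0//; exact: outdist_ge0.
Qed.

(** Multiplying by G turns max (0, 1 - W / G) into max (0, G - W); where G = 0 the latter vanishes
    as well, because W >= 0. *)
Let mean_f : \sum_z IG psi z * f z = dTV IG IW psi.
Proof.
rewrite dTVE; apply: eq_bigr => z _; rewrite /f.
have [Gz|Gz] := eqVneq (IG psi z) 0.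
  by rewrite Gz mul0r max_l// sub0r oppr_le0 outdist_ge0.
rewrite maxr_pMr ?outdist_ge0// mulr0 mulrBr mulr1; congr (Num.max 0 (_ - _)).
by rewrite mulrC divfK.
Qed.

Lemma cpe_halts_measurable : measurable cpe_halts.
Proof.
rewrite (_ : cpe_halts = \bigcap_(j in setT) \bigcap_(i in setT)
   [set om | halts (bits (j : 'I_alpha) (x j om) i) k om]).
  apply: fin_bigcap_measurable => // j _; apply: fin_bigcap_measurable => // i _.
  rewrite (_ : mkset _ = \bigcup_(z in setT) (x j @^-1` [set z] `&`
      [set om | halts (bits j z i) k om])).
    apply: fin_bigcup_measurable => // z _; apply: measurableI.
      exact: (x_set1_measurable tapes).
    apply: (measurable_halts R) => t'.
    by apply: (block_fun_measurable tapes (S := setT)); exact: call_bits_measurable.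
  apply/seteqP; split=> om /=; first by move=> h; exists (x j om).
  by move=> [z _ [/= -> h]].
by apply/seteqP; split=> om h j; [move=> _ i _|move=> i]; exact: h.
Qed.

Lemma cpe_value_measurable : measurable_fun setT cpe_value.
Proof.
apply: measurable_funM => //; apply: measurable_sum => j.
pose h z om : R := Num.max 0 (1 - IW psi z /
   \prod_i ((k%:R - 1) / call_r w a SubCond psi k j z i om)).
apply: (measurable_finite_comp (x_set1_measurable tapes j) (h := h)) => z.
apply: measurable_maxr => //; apply: measurable_funB => //; apply: measurable_funM => //.
under eq_fun do rewrite -prodfV; apply: measurable_prod => i _.
under eq_fun do rewrite invf_div.
apply: measurable_funM => //.
apply: (block_fun_measurable tapes (S := setT)); apply: measurable_stop_clock => //.
  exact: call_bits_measurable.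
exact: call_clock_measurable.
Qed.

Lemma cpe_correct :
  (P [set om | exists (dhat : R) (N : nat), run om = Some (dhat, N) /\
        (dTV IG IW psi - zeta <= dhat <= dTV IG IW psi + zeta)%R]
     >= (1 - delta)%:E)%E.
Proof.
set mu := dTV IG IW psi.
have -> : [set om | exists (dhat : R) (N : nat), run om = Some (dhat, N) /\
        (mu - zeta <= dhat <= mu + zeta)%R] =
    cpe_halts `&` [set om | (mu - zeta <= cpe_value om <= mu + zeta)%R].
  apply/seteqP; split=> om /=.
    move=> [v [N [rE vb]]]; have [h|/run_None] := pselect (cpe_halts om); last by rewrite rE.
    by split=> //; have [N' rE'] := run_halts h; move: rE; rewrite rE' => -[-> _].
  by move=> [/run_halts[N rE] vb]; exists (cpe_value om), N.
set S := _ `&` _.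
have mS : measurable S.
  apply: measurableI; first exact: cpe_halts_measurable.
  apply: measurable_set_bool; apply: measurable_and; apply: measurable_fun_ler => //;
  exact: cpe_value_measurable.
(* Failure budget: delta / 4 for each Hoeffding tail, the lower one applied to 1 - f, and alpha
   delta' = delta / 2 for the runs of Est. *)
pose U := [set om | (alpha%:R * (mu + t) <= \sum_(j < alpha) f (x j om))%R].
pose V := [set om | (alpha%:R * ((1 - mu) + t) <= \sum_(j < alpha) (1 - f (x j om)))%R].
pose B (j : 'I_alpha) := [set om | ~ est_good w a IG SubCond psi k D j (x j om) om].
have mf (g : n.-tuple bool -> R) : measurable_fun setT (fun om => \sum_(j < alpha) g (x j om)).
  apply: measurable_sum => j; apply: (block_fun_measurable tapes (S := setT)).
  exact: measurable_fx.
have mU : measurable U by apply: measurable_set_bool; apply: measurable_fun_ler.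
have mV : measurable V.
  by apply: measurable_set_bool; apply: measurable_fun_ler => //; exact: (mf (fun z => 1 - f z)).
have mB j : measurable (B j).
  rewrite (_ : B j = \bigcup_(z in setT) (x j @^-1` [set z] `&`
     ~` est_good w a IG SubCond psi k D j z)).
    apply: fin_bigcup_measurable => // z _; apply: measurableI.
      exact: (x_set1_measurable tapes).
    apply: measurableC; apply: (block_space_measurable (tape_measurable tapes) (S := setT)).
    exact: est_good_measurable.
  apply/seteqP; split=> om /=; first by move=> h; exists (x j om).
  by move=> [z _ [/= <- h]].
(* The accuracy of Est is only known for strings of positive probability; sampling any other string
   is a null event. *)
have mZ (j : 'I_alpha) : measurable [set om | (IG psi (x j om) <= 0)%R].
  apply: measurable_set_bool; apply: measurable_fun_ler => //.
  by apply: (block_fun_measurable tapes (S := setT)); exact: measurable_fx.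
have PZ (j : 'I_alpha) : P [set om | (IG psi (x j om) <= 0)%R] = 0%E.
  rewrite (probability_finite_pred (fun z => x_set1_measurable tapes j z) (f := IG psi)
    (fun z => IG psi z <= 0)); last exact: (tape_x_law tapes).
  rewrite big1// => z Gz; by apply/le_anti; rewrite Gz outdist_ge0.
have eL : (2 * n%:R * expR (- L) = delta').
  rewrite expRN /L lnK ?posrE ?divr_gt0 ?mulr_gt0//.
  by rewrite invf_div mulrC divfK// gt_eqF// mulr_gt0.
have PB j : (P (B j) <= delta'%:E)%E.
  rewrite -eL; apply: (est_bad_x_prob G_cond tapes k_gt0 n_gt0 t_bounds) => //.
(* With tolerance t = zeta / 2 the exponent 2 alpha t^2 = alpha zeta^2 / 2 is at least ln (4 /
   delta), which is what the choice of alpha is for. *)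
have ht : expR (- (2 * alpha%:R * t ^+ 2)) <= delta / 4.
  have -> : delta / 4 = expR (- ln (4 / delta)).
    by rewrite expRN lnK ?posrE ?divr_gt0// invf_div.
  rewrite ler_expR lerN2.
  have -> : ln (4 / delta) = 2 / zeta ^+ 2 * ln (4 / delta) * (zeta ^+ 2 / 2).
    by field; rewrite gt_eqF.
  have -> : 2 * alpha%:R * t ^+ 2 = alpha%:R * (zeta ^+ 2 / 2) by rewrite /t; field.
  by rewrite ler_pM2r// divr_gt0// exprn_gt0.
have t0 : 0 < t by case/andP: t_bounds.
have PU : (P U <= (delta / 4)%:E)%E.
  apply: (le_trans (hoeffding_tail tapes f01 mean_f alpha t0)).
  by rewrite lee_fin.
have PV : (P V <= (delta / 4)%:E)%E.
  apply: (le_trans (hoeffding_tail tapes (f := fun z => 1 - f z) (mu := 1 - mu) _ _ alpha t0)).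
  - by move=> z; have := f01 z; lra.
  - transitivity (\sum_z (IG psi z - IG psi z * f z)).
      by apply: eq_bigr => z _; rewrite mulrBr mulr1.
    by rewrite sumrB outdist_sum1 mean_f.
  - by rewrite lee_fin.
have sub : ~` S `<=` (U `|` V) `|`
    (\big[setU/set0]_(j < alpha) (B j `|` [set om | (IG psi (x j om) <= 0)%R])).
  move=> om; apply: contra_notP => /not_orP[/not_orP[nU nV] nB].
  have {}nB (j : 'I_alpha) : ~ (B j `|` [set om | (IG psi (x j om) <= 0)%R]) om.
    by move=> h; apply: nB; rewrite -bigcup_seq; exists j => //=; rewrite mem_index_enum.
  have good (j : 'I_alpha) : est_good w a IG SubCond psi k D j (x j om) om.
    by apply/not_notP => h; apply: (nB j); left.
  have Gx (j : 'I_alpha) : 0 < IG psi (x j om).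
    by rewrite ltNge; apply/negP => h; apply: (nB j); right.
  split; first by move=> j i; case: (good j) => + _; exact.
  have {}nU : \sum_(j < alpha) f (x j om) < alpha%:R * (mu + t).
    by rewrite ltNge; apply/negP.
  have {}nV : \sum_(j < alpha) (1 - f (x j om)) < alpha%:R * ((1 - mu) + t).
    by rewrite ltNge; apply/negP.
  move: nV; rewrite sumrB sumr_const card_ord => nV.
  pose v (j : 'I_alpha) := Num.max 0 (1 - IW psi (x j om) /
    \prod_i ((k%:R - 1) / call_r w a SubCond psi k j (x j om) i om)).
  have err j : `|v j - f (x j om)| <= t.
    apply: (est_good_error G_cond (D := D) (L := L)) => //; exact: outdist_ge0.
  have vb : `|\sum_j v j - \sum_(j < alpha) f (x j om)| <= alpha%:R * t.
    rewrite -sumrB; apply: (le_trans (ler_norm_sum _ _ _)).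
    apply: (@le_trans _ _ (\sum_(j < alpha) t)); first by apply: ler_sum => j _; exact: err.
    by rewrite sumr_const card_ord mulr_natl.
  have tz : t + t = zeta by rewrite /t; field.
  rewrite /= /cpe_value -/(v _) ler_pdivlMr// ler_pdivrMr//.
  move: vb; rewrite ler_norml => /andP[vb1 vb2].
  rewrite -tz; apply/andP; split; lra.
have PS : (P (~` S) <= delta%:E)%E.
  apply: (@le_trans _ _ (P ((U `|` V) `|`
     (\big[setU/set0]_(j < alpha) (B j `|` [set om | (IG psi (x j om) <= 0)%R]))))).
    apply: le_measure => //; rewrite inE; first exact: measurableC.
    apply: measurableU; first exact: measurableU.
    by apply: bigsetU_measurable => j _; exact: measurableU.
  apply: (le_trans (probabilityU_le _ _ _)); first exact: measurableU.
    by apply: bigsetU_measurable => j _; exact: measurableU.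
  have -> : delta = (delta / 4 + delta / 4) + alpha%:R * delta'.
    by rewrite /delta'; field; rewrite gt_eqF.
  rewrite EFinD; apply: leeD.
    by apply: (le_trans (probabilityU_le _ _ _)) => //; rewrite EFinD; exact: leeD.
  apply: (le_trans (probability_bigU_le _ _ _)); first by move=> j; exact: measurableU.
  apply: (@le_trans _ _ (\sum_(j < alpha) delta'%:E)%E); last first.
    by rewrite sumEFin lee_fin sumr_const card_ord mulr_natl.
  apply: lee_sum => j _; apply: (le_trans (probabilityU_le _ _ _)) => //.
  by rewrite PZ adde0.
have : P S = (1 - P (~` S))%E.
  by rewrite -{1}[S]setCK probability_setC//; exact: measurableC.
move=> ->; rewrite EFinB; apply: leeB => //.
Qed.

End cube_probe.

Unset Implicit Arguments.

Theorem theorem1 (R : realType) (delta : R) (delta_gt0 : 0 < delta)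
    (delta_lt : delta < 1 / 3) :
  exists (C : R) (c : nat),
  forall (m n : nat) (IG IW : sampler R m n)
    (SubCond : m.-tuple bool -> seq bool -> m.-tuple bool)
    (psi : m.-tuple bool) (zeta : R)
    (d : measure_display) (Om : measurableType d) (P : probability Om R)
    (x : nat -> Om -> n.-tuple bool)
    (w : nat -> 'I_n -> nat -> m.-tuple bool -> Om -> n.-tuple bool)
    (a : nat -> 'I_n -> nat -> Om -> R),
  (0 < n)%N ->
  is_subcond IG SubCond ->
  self_reducible IW ->
  0 < zeta < 1 ->
  random_tapes P x w a IG psi ->
  let run (om : Om) : outcome R :=
    cube_probe_est SubCond (IW psi) (fun j => x j om)
      (fun j i t phi => w j i t phi om) (fun j i t => a j i t om)
      psi zeta delta in
  (P [set om | exists (dhat : R) (N : nat), run om = Some (dhat, N) /\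
        (dTV IG IW psi - zeta <= dhat <= dTV IG IW psi + zeta)%R]
     >= (1 - delta)%:E)%E
  /\
  (\int[P]_om nsamples R (run om)
     <= (C * (n%:R ^+ 2 / zeta ^+ 4) * (1 + ln (n%:R / zeta)) ^+ c)%:E)%E.
Proof.
have [C CP] := sample_complexity delta_gt0 delta_lt.
exists C, 1%N => m n IG IW SubCond psi zeta d Om P x w a n_gt0 Gc _ z01 tapes run.
split; first exact: (cpe_correct IW n_gt0 Gc z01 delta_gt0 delta_lt tapes).
have := integral_nsamples_run IW zeta delta Gc tapes.
cbv zeta => /le_trans; apply.
by rewrite lee_fin expr1; exact: CP n zeta n_gt0 z01.
Qed.
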